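(* Let $R$ be a finite commutative ring. For $n\ge1$ let $d_n=\operatorname{rk}\mathrm{St}_n(R)$, and set $d_0=1$. Then for all $n\ge1$, $$d_n=\sum_{i=1}^n(-1)^{i-1}\,\bigl|\mathrm{Gr}^n_{n-i}(R)\bigr|\,d_{n-i}.$$
   Context: A flag in $R^n$ is a chain $0\subsetneq V_1\subsetneq\cdots\subsetneq V_k\subsetneq R^n$ of free direct summands; complete if $k=n-1$, good if it is a subflag of a complete flag. The Tits complex $\mathcal{T}_n(R)$ has as vertices the direct summands $V$ of $R^n$, $0\ne V\ne R^n$, with $V$ and $R^n/V$ free, and a $k$-simplex for every good flag with $k+1$ terms. $\mathrm{St}_n(R)=\tilde H_{n-2}(\mathcal{T}_n(R);\mathbb{Z})$ (a free abelian group; note $\mathrm{St}_1(R)=\tilde H_{-1}(\emptyset)\cong\mathbb{Z}$). For $n\ge k\ge0$, the Grassmannian $\mathrm{Gr}^n_k(R)$ is the set of rank $k$ direct summands $V$ of $R^n$ such that $V$ and $R^n/V$ are free; $|\mathrm{Gr}^n_0(R)|=1$. *)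

(* Defs.v *)
From HB Require Import structures.
From mathcomp Require Import all_boot all_order all_algebra.
From mathcomp Require Import boolp.
Set Implicit Arguments. Unset Strict Implicit. Unset Printing Implicit Defensive.
Import Order.TTheory GRing.Theory Num.Theory.
Local Open Scope ring_scope.

(* Reduced homology ranks of a finite (augmented) simplicial complex  *)
(* whose faces are given as a set F of finite vertex sets (including  *)
(* the empty face), vertices ordered by a strict order [lt] (faces    *)
(* are chains for [lt]).  Ranks are computed over Q, i.e. the rank of *)
(* the f.g. abelian group H~_k(.;Z) as dim_Q (H~_k(.;Z) (x) Q).       *)

Section Homology.
Variables (X : finType) (F : {set {set X}}) (lt : rel X).

(* faces with exactly m vertices (= (m-1)-simplices) *)
Definition faces_sz (m : nat) : {set {set X}} := [set S in F | #|S| == m].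

Definition bd_coef (S T : {set X}) : rat :=
  if T \subset S then
    if [pick x in S :\: T] is Some x then (-1) ^+ #|[set w in S | lt w x]|
    else 0
  else 0.

(* matrix of the boundary C_p -> C_{p-1} (p = m-1), row-vector convention:
   rows indexed by faces with p.+1 vertices, columns by faces with p vertices *)
Definition bd_mx (p : nat) : 'M[rat]_(#|faces_sz p.+1|, #|faces_sz p|) :=
  \matrix_(i, j) bd_coef (enum_val i) (enum_val j).

(* rank of the reduced homology in dimension m-1:
   dim ker(d_{m-1}) - dim im(d_m) *)
Definition red_betti (m : nat) : nat :=
  (#|faces_sz m| - (if m is p.+1 then \rank (bd_mx p) else 0%N)
     - \rank (bd_mx m))%N.

End Homology.

Section Modules.
Variables (R : finComNzRingType) (n : nat).
Local Notation vec := 'rV[R]_n.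

Definition submod (V : {set vec}) : Prop :=
  0 \in V /\ (forall u v, u \in V -> v \in V -> u + v \in V) /\
  (forall (a : R) v, v \in V -> a *: v \in V).

Definition free_rank (V : {set vec}) (k : nat) : Prop :=
  exists B : 'M[R]_(k, n),
    (forall u : 'rV[R]_k, u *m B = 0 -> u = 0) /\ V = [set u *m B | u : 'rV[R]_k].

Definition is_free (V : {set vec}) : Prop := exists k, free_rank V k.

(* R^n / V is free of rank m: the images of the rows of C in R^n/V form a basis *)
Definition quot_free_rank (V : {set vec}) (m : nat) : Prop :=
  exists C : 'M[R]_(m, n),
    (forall u : 'rV[R]_m, u *m C \in V -> u = 0) /\
    (forall x : vec, exists u : 'rV[R]_m, x - u *m C \in V).

Definition quot_free (V : {set vec}) : Prop := exists m, quot_free_rank V m.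

Definition direct_summand (V : {set vec}) : Prop :=
  submod V /\ exists W : {set vec}, submod W /\ V :&: W = [set 0] /\
    forall x : vec, exists v w, v \in V /\ w \in W /\ x = v + w.

Definition Grass (k : nat) : {set {set vec}} :=
  [set V : {set vec} | `[< direct_summand V /\ free_rank V k /\ quot_free V >]].

Definition tits_vertex (V : {set vec}) : Prop :=
  direct_summand V /\ V != [set 0] /\ V != [set: vec] /\ is_free V /\ quot_free V.

(* a flag, viewed as the set of its terms: free direct summands V with
   0 <> V <> R^n, pairwise comparable (hence a strict chain) *)
Definition is_flag (S : {set {set vec}}) : Prop :=
  (forall V, V \in S -> [/\ direct_summand V, is_free V, V != [set 0] & V != [set: vec]])
  /\ (forall V W, V \in S -> W \in S -> V \subset W \/ W \subset V).

Definition complete_flag (S : {set {set vec}}) : Prop :=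
  is_flag S /\ #|S| = n.-1.

Definition good_flag (S : {set {set vec}}) : Prop :=
  is_flag S /\ exists C, complete_flag C /\ S \subset C.

Definition tits_faces : {set {set {set vec}}} :=
  [set S : {set {set vec}} | `[< (forall V : {set vec}, V \in S -> tits_vertex V) /\ good_flag S >]].

(* d_n = rk St_n(R) = rk H~_{n-2}(T_n(R); Z) for n >= 1, d_0 = 1 *)
Definition stRank : nat :=
  if n is 0 then 1%N
  else red_betti tits_faces (fun V W : {set vec} => V \proper W) n.-1.

End Modules.

(* Main.v *)
Require Import Defs.
From HB Require Import structures.
From mathcomp Require Import all_boot all_order all_algebra.
From mathcomp Require Import boolp ring lra zify.
Set Implicit Arguments. Unset Strict Implicit. Unset Printing Implicit Defensive.
Import Order.TTheory GRing.Theory Num.Theory.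
Local Open Scope ring_scope.

(* The Tits complex of R^n is acyclic below its top dimension n - 2 (a
   Solomon-Tits theorem), so d_n is up to sign its reduced Euler
   characteristic; grouping the nonempty flags by their largest term V, a flag
   being a flag of V = R^k together with V, gives the recursion.

   For acyclicity, fix v in R^n and consider the summands W such that v stays
   nonzero in R^n / W at the residue fields where it is nonzero.  Starting from
   those in general position to a fixed line, add the other ones by decreasing
   size: the link of W is the join of the summands above W, a complex of the
   same kind in R^n / W, and of those below W in general position, a complex of
   the same kind in W, so that induction on the rank applies.  Idempotents of R
   replace the decomposition of R into local rings. *)

(** * Clique complexes *)

(** The plain Tits complex is not stable under the induction: attaching [W] retains below it only
    the summands in general position to a line. The statement proved is therefore about
    [avoiding A B v e]. The vector [u] that spans the line below [W] may vanish at some residue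
    fields even if the original vector does not, hence a condition [pairing u f = h] with [h]
    idempotent rather than [1].

    Finiteness of [R] enters in three ways. A fixed power of every element is idempotent, which
    supplies the idempotents. The rank of a summand is read off its cardinality. Finally, the
    quotient by a free summand of smaller rank has a unimodular vector ([unimodular_ker]), so that
    quotients are free and every gap of ranks in a flag can be filled. Thus all flags are good, and
    the Tits complex is the clique complex of proper inclusion. *)

Section CliqueComplex.
Variables (X : finType) (cmp lt : rel X).
Hypothesis cmp_sym : symmetric cmp.
Hypothesis cmp_irr : irreflexive cmp.
Hypothesis lt_tour : forall x y, x != y -> lt x y = ~~ lt y x.
Implicit Types (x y : X) (S T P Q G : {set X}) (z w : {set X} -> rat).

Definition sgn x T : rat := (-1) ^+ #|[set w in T | lt w x]|.

Definition bd z T : rat := \sum_(x | x \notin T) sgn x T * z (x |: T).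

(** The cone over [z] with apex [x]; terms of [z] that contain [x] are discarded. *)
Definition wedge x z S : rat := if x \in S then sgn x (S :\ x) * z (S :\ x) else 0.

Lemma sgn_sqr x T : sgn x T * sgn x T = 1.
Proof. by rewrite /sgn -expr2 sqrr_sign. Qed.

Lemma sgnU1 x y T : y \notin T -> sgn x (y |: T) = (-1) ^+ lt y x * sgn x T.
Proof.
move=> yT; rewrite /sgn -exprD; congr (_ ^+ _).
have -> : [set w in y |: T | lt w x] =
    if lt y x then y |: [set w in T | lt w x] else [set w in T | lt w x].
  apply/setP=> w; case: ifP => yx; rewrite !inE; case: eqVneq => [->|] //=.
  by rewrite yx (negbTE yT).
by case: ifP => //= _; rewrite cardsU1 inE (negbTE yT).
Qed.

Lemma sgn_swap x y T : x != y -> x \notin T -> y \notin T ->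
  sgn x T * sgn y (x |: T) = - (sgn y T * sgn x (y |: T)).
Proof.
move=> xy xT yT; rewrite !sgnU1 // (lt_tour xy).
by case: (lt y x) => /=; rewrite ?expr0 ?expr1; ring.
Qed.

Lemma sgn_swapU x y T : x != y -> x \notin T -> y \notin T ->
  sgn y (x |: T) * sgn x (y |: T) = - (sgn x T * sgn y T).
Proof.
move=> xy xT yT; rewrite !sgnU1 // (lt_tour xy).
by case: (lt y x) => /=; rewrite ?expr0 ?expr1; ring.
Qed.

(** The cone homotopy formula. It also covers terms of [z] through [x]: for [x \in T], the summand
    at [x] of [bd z (T :\ x)] gives back [z T], and the others match by [sgn_swapU]. *)
Lemma bd_wedge x z T : bd (wedge x z) T = z T - wedge x (bd z) T.
Proof.
rewrite /wedge; case: ifP => xT; last first.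
  rewrite subr0 /bd (bigD1 x) ?xT //= big1 ?addr0; last first.
    move=> y /andP[yT yx]; rewrite in_setU1 xT orbF eq_sym (negbTE yx).
    by rewrite mulr0.
  by rewrite setU11 setU1K ?xT // mulrA sgn_sqr mul1r.
rewrite {2}/bd (bigD1 x) ?setD11 //= mulrDr mulrA sgn_sqr mul1r setD1K //.
rewrite opprD addNKr /bd mulr_sumr -sumrN.
apply: eq_big => [y|y yT].
  by rewrite !inE; case: eqVneq => [->|]; rewrite ?xT //= andbT.
have xy : x != y by apply: contraNneq yT => <-.
rewrite setU1r //.
have -> : (y |: T) :\ x = y |: (T :\ x).
  by apply/setP=> w; rewrite !inE; case: (eqVneq w y) => [->|] //=; rewrite eq_sym xy.
have yT' : y \notin T :\ x by rewrite !inE negb_and (negbTE yT) orbT.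
rewrite !mulrA -mulNr; congr (_ * _).
by rewrite -[T in sgn y T](setD1K xT) sgn_swapU // setD11.
Qed.

Lemma bd_bd z T : bd (bd z) T = 0.
Proof.
have E : bd (bd z) T = \sum_(x | x \notin T) \sum_(y | y \notin x |: T)
    sgn x T * (sgn y (x |: T) * z (y |: (x |: T))).
  by apply: eq_bigr => x _; rewrite mulr_sumr.
suff H : bd (bd z) T = - bd (bd z) T by lra.
rewrite {1}E [in RHS]E.
rewrite [LHS](exchange_big_dep (fun y => y \notin T)) /=; last first.
  by move=> x y _; rewrite !inE negb_or => /andP[].
rewrite -sumrN; apply: eq_bigr => y yT; rewrite -sumrN.
apply: eq_big => [x|x].
  by rewrite !inE !negb_or eq_sym yT andbT andbC.
rewrite !inE negb_or => /andP[xT /andP[yx _]].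
rewrite !mulrA -mulNr setUCA; congr (_ * _).
by rewrite sgn_swap // eq_sym.
Qed.

Lemma bd0 z T : (forall S, z S = 0) -> bd z T = 0.
Proof. by move=> z0; rewrite /bd big1 // => x _; rewrite z0 mulr0. Qed.

Lemma bdD z w T : bd (fun S => z S + w S) T = bd z T + bd w T.
Proof. by rewrite /bd -big_split; apply: eq_bigr => x _; rewrite mulrDr. Qed.

Lemma bdB z w T : bd (fun S => z S - w S) T = bd z T - bd w T.
Proof.
by rewrite /bd -sumrB; apply: eq_bigr => x _; rewrite mulrBr.
Qed.

Lemma eq_bd z w : z =1 w -> bd z =1 bd w.
Proof. by move=> zw T; apply: eq_bigr => x _; rewrite zw. Qed.

Definition clique S := [forall x in S, forall y in S, (x != y) ==> cmp x y].

Lemma cliqueP S :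
  reflect (forall x y, x \in S -> y \in S -> x != y -> cmp x y) (clique S).
Proof.
apply: (iffP forall_inP) => [H x y xS yS xy|H x xS].
  by have /forall_inP/(_ y yS)/implyP := H x xS; apply.
by apply/forall_inP => y yS; apply/implyP; apply: H.
Qed.

Definition supported P m z :=
  forall S, z S != 0 -> [/\ S \subset P, clique S & #|S| = m].

(* Exactness at the faces with [m] vertices, of dimension [m - 1]. *)
Definition exact_at P m := forall z, supported P m z -> (forall T, bd z T = 0) ->
  exists2 w, supported P m.+1 w & forall T, bd w T = z T.

Definition nbrs P x := [set y in P | cmp x y].

(* [spherical m P]: a recipe showing that the clique complex of [P] is acyclic
   below dimension [m - 1]; joins are handled by induction on the recipe,
   without a Kuenneth formula. *)
Inductive spherical : nat -> {set X} -> Prop :=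
| Spherical0 P : spherical 0 P
| SphericalCone m P x : x \in P ->
    (forall y, y \in P -> y != x -> cmp x y) -> spherical m P
| SphericalAdd m P x : x \in P -> spherical m (P :\ x) -> spherical m.-1 (nbrs P x) ->
    spherical m P.

Lemma cliqueU1 x S : clique S -> (forall y, y \in S -> y != x -> cmp x y) ->
  clique (x |: S).
Proof.
move=> /cliqueP cS xS; apply/cliqueP => a b; rewrite !inE.
move=> /predU1P[->|aS] /predU1P[->|bS]; rewrite ?eqxx //.
- by move=> xb; apply: xS => //; rewrite eq_sym.
- by move=> ax; rewrite cmp_sym; apply: xS.
- exact: cS.
Qed.

Lemma sub_clique S T : S \subset T -> clique T -> clique S.
Proof.
by move=> /subsetP ST /cliqueP cT; apply/cliqueP => x y /ST xT /ST; apply: cT.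
Qed.

Lemma cone_exact P x : x \in P -> (forall y, y \in P -> y != x -> cmp x y) ->
  forall m, exact_at P m.
Proof.
move=> xP cx m z sz dz; exists (wedge x z); last first.
  move=> T; rewrite bd_wedge /wedge; case: ifP => _; rewrite ?subr0 //.
  by rewrite dz mulr0 subr0.
move=> S; rewrite /wedge; case: ifP => [xS|]; last by rewrite eqxx.
rewrite mulf_eq0 negb_or => /andP[_ /sz[SP cS cardS]].
rewrite -(setD1K xS); split.
- by rewrite subUset sub1set xP.
- by apply: cliqueU1 => // y yS; apply: cx; apply: (subsetP SP).
- by rewrite cardsU1 setD11 cardS.
Qed.

(** A Mayer-Vietoris argument on chains. Write [z] as [z'] plus the cone over a chain [y] of the
    link of [x]. Then [y] is a cycle, hence some [bd w], and [z' + w] is a cycle avoiding [x], hence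
    some [bd u]. The chain [u] minus the cone over [w] bounds to [z]. *)
Lemma add_exact P x m : x \in P -> exact_at (P :\ x) m ->
  (if m is k.+1 then exact_at (nbrs P x) k else True) -> exact_at P m.
Proof.
move=> xP exD exL z sz dz.
pose y S := if x \in S then 0 else sgn x S * z (x |: S).
pose z' S := if x \in S then 0 else z S.
have zE S : z S = z' S + wedge x y S.
  rewrite /z' /wedge /y; case: ifP => xS; last by rewrite addr0.
  by rewrite setD11 mulrA sgn_sqr mul1r setD1K // add0r.
have bdzE T : bd z T = bd z' T + (y T - wedge x (bd y) T).
  by rewrite (eq_bd zE) bdD bd_wedge.
have bd_off u T : (forall S, x \in S -> u S = 0) -> x \in T -> bd u T = 0.
  by move=> u0 xT; rewrite /bd big1 // => a _; rewrite u0 ?mulr0 // setU1r.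
have y_on S : x \in S -> y S = 0 by rewrite /y => ->.
have dy T : bd y T = 0.
  have [xT|xT] := boolP (x \in T); first exact: bd_off.
  have := bdzE (x |: T); rewrite dz bd_off ?setU11 //; last first.
    by move=> S; rewrite /z' => ->.
  rewrite y_on ?setU11 // /wedge setU11 setU1K // add0r sub0r.
  by move/eqP; rewrite eq_sym oppr_eq0 mulf_eq0 signr_eq0 /= => /eqP.
have [w sw dw] : exists2 w, supported (nbrs P x) m w & forall T, bd w T = y T.
  have ys S : y S != 0 -> [/\ S \subset nbrs P x, clique S & #|S|.+1 = m].
    rewrite /y; case: ifP => [|/negbT xS]; first by rewrite eqxx.
    rewrite mulf_eq0 negb_or => /andP[_ /sz[]].
    rewrite subUset => /andP[_ SP] cS; rewrite cardsU1 xS => cardS.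
    split=> //; last by apply: sub_clique cS; apply: subsetUr.
    apply/subsetP => a aS; rewrite inE (subsetP SP) //=.
    move/cliqueP: cS; apply; rewrite ?setU11 ?setU1r //.
    by apply: contraNneq xS => ->.
  (* For [m = 0] the chain [y] would live on sets of size [-1], so it is zero. *)
  case: m exL {exD sz} ys => [_|m exL] ys.
    exists (fun=> 0) => [S|T]; first by rewrite eqxx.
    rewrite bd0 //; apply/esym/eqP/negPn/negP => /ys[_ _]; discriminate.
  apply: exL => // S /ys[? ?]; by case.
have [u su du] : exists2 u, supported (P :\ x) m.+1 u &
    forall T, bd u T = z' T + w T.
  apply: exD => [S|T].
    have [wS|/negPn/eqP->] := boolP (w S != 0).
      move=> _; have [SN cS cardS] := sw _ wS; split=> //.
      apply: subset_trans SN _; apply/subsetP => a; rewrite !inE.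
      by case/andP=> aP; case: eqVneq => // ->; rewrite cmp_irr.
    rewrite addr0 /z'; case: ifP => [|/negbT xS /sz[SP cS cardS]].
      by rewrite eqxx.
    by split=> //; rewrite subsetD1 SP.
  rewrite bdD dw; have := bdzE T; rewrite dz /wedge dy => ->.
  by rewrite mulr0 if_same subr0.
exists (fun S => u S - wedge x w S) => [S|T]; last first.
  rewrite bdB bd_wedge du zE /wedge dw; lra.
have [/su[SP cS cardS] _|/negPn/eqP->] := boolP (u S != 0).
  by split=> //; apply: subset_trans SP (subsetDl _ _).
rewrite sub0r oppr_eq0 /wedge; case: ifP => [xS|]; last by rewrite eqxx.
rewrite mulf_eq0 negb_or => /andP[_ /sw[SP cS cardS]].
rewrite -(setD1K xS); split.
- rewrite subUset sub1set xP (subset_trans SP) //.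
  by apply/subsetP => a; rewrite inE => /andP[].
- by apply: cliqueU1 => // a /(subsetP SP); rewrite inE => /andP[].
- by rewrite cardsU1 setD11 cardS.
Qed.

Lemma spherical_exact m P : spherical m P -> forall k, (k < m)%N -> exact_at P k.
Proof.
elim=> {m P} [//|m P x xP cx k _|m P x xP _ IHD _ IHL k km].
  exact: cone_exact cx k.
apply: (add_exact xP); first exact: IHD.
by case: k km => // k km; apply: IHL; rewrite -ltnS (ltn_predK km).
Qed.

Lemma spherical_leq m n P : (n <= m)%N -> spherical m P -> spherical n P.
Proof.
move=> nm sP; elim: sP n nm => {m P} [P|m P x xP cx|m P x xP _ IHD _ IHL] n nm.
- by move: nm; rewrite leqn0 => /eqP->; apply: Spherical0.
- exact: SphericalCone xP cx.
- apply: (SphericalAdd xP); first exact: IHD.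
  by apply: IHL; rewrite -!subn1 leq_sub2r.
Qed.

Lemma setUD1l P Q x : x \notin Q -> (P :|: Q) :\ x = (P :\ x) :|: Q.
Proof.
move=> xQ; apply/setP=> y; rewrite !inE.
by case: eqVneq => [->|] //=; rewrite (negbTE xQ).
Qed.

(** Covers a [P] about which nothing is known: its vertices are added to [Q] one at a time, and each
    link has the same form with a smaller left part. *)
Lemma spherical_joinr m P Q : (forall x y, x \in P -> y \in Q -> cmp x y) ->
  spherical m Q -> spherical m (P :|: Q).
Proof.
move: {2}#|P| (erefl #|P|) => c; elim/ltn_ind: c m P => c IH m P cP PQ sQ.
have [->|[x xP]] := set_0Vmem P; first by rewrite set0U.
have xQ : x \notin Q by apply/negP => /(PQ x x xP); rewrite cmp_irr.
apply: (@SphericalAdd _ _ x); first by rewrite inE xP.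
  rewrite setUD1l //.
  apply: (IH #|P :\ x|) => //; first by rewrite -cP (cardsD1 x P) xP.
  by move=> a b; rewrite inE => /andP[_]; apply: PQ.
have -> : nbrs (P :|: Q) x = nbrs P x :|: Q.
  apply/setP=> y; rewrite !inE andb_orl; congr (_ || _).
  by apply: andb_idr; apply: PQ.
apply: (IH #|nbrs P x|) => //.
- rewrite -cP; apply: proper_card; apply/properP; split.
    by apply/subsetP=> a; rewrite inE => /andP[].
  by exists x => //; rewrite inE cmp_irr andbF.
- by move=> a b; rewrite inE => /andP[aP _]; apply: PQ.
- by apply: spherical_leq sQ; apply: leq_pred.
Qed.

Lemma spherical_join m n P Q : (forall x y, x \in P -> y \in Q -> cmp x y) ->
  spherical m P -> spherical n Q -> spherical (m + n) (P :|: Q).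
Proof.
move=> PQ sP sQ; elim: sP PQ => {m P} [P|m P x xP cx|m P x xP _ IHD _ IHL] PQ.
- exact: spherical_joinr.
- apply: (@SphericalCone _ _ x); first by rewrite inE xP.
  by move=> y; rewrite inE => /orP[/cx//|yQ _]; apply: PQ.
have xQ : x \notin Q by apply/negP => /(PQ x x xP); rewrite cmp_irr.
have sD : spherical (m + n) ((P :|: Q) :\ x).
  rewrite setUD1l //.
  by apply: IHD => a b; rewrite inE => /andP[_]; apply: PQ.
apply: (SphericalAdd _ sD); first by rewrite inE xP.
have -> : nbrs (P :|: Q) x = nbrs P x :|: Q.
  apply/setP=> y; rewrite !inE andb_orl; congr (_ || _).
  by apply: andb_idr; apply: PQ.
(* For [m = 0] the predecessor does not drop, and the link is better than required. *)
apply: (@spherical_leq (m.-1 + n)).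
  by case: m {IHD IHL sD} => // ; rewrite leq_pred.
by apply: IHL => a b; rewrite inE => /andP[aP _]; apply: PQ.
Qed.

(** [P] grows out of [G] by decreasing [key]: when [x] arrives, its neighbours already present lie
    in [G] or have a larger key. The proof reads this backwards, removing a vertex of minimal key
    outside [G]. *)
Lemma spherical_attach (key : X -> nat) m G P : G \subset P ->
  (forall x y, cmp x y -> key x != key y) ->
  spherical m G ->
  (forall x, x \in P -> x \notin G ->
    spherical m.-1 [set y in P | cmp x y & (y \in G) || (key x < key y)%N]) ->
  spherical m P.
Proof.
move: {2}#|P :\: G| (erefl #|P :\: G|) => c.
elim: c P => [|c IH] P cP GP keyP sG sL.
  suff -> : P = G by [].
  by apply/eqP; rewrite eqEsubset GP andbT -setD_eq0 -cards_eq0 cP.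
have [x0 x0P] : exists x0, x0 \in P :\: G by apply/card_gt0P; rewrite cP.
case: (arg_minnP key x0P) => x /= xPG xmin {x0 x0P}.
have {}xPG : x \in P :\: G := xPG.
have /setDP[xP xG] := xPG.
apply: (SphericalAdd xP).
  apply: IH => //.
  - apply/eqP; rewrite -eqSS -cP (cardsD1 x (P :\: G)) xPG add1n eqSS.
    apply/eqP; congr #|pred_of_set _|; apply/setP=> y.
    by rewrite !inE; case: (y == x); rewrite ?andbF.
  - by rewrite subsetD1 GP.
  - move=> y /setD1P[yx yP] yG.
    suff -> : [set w in P :\ x | cmp y w & (w \in G) || (key y < key w)%N] =
      [set w in P | cmp y w & (w \in G) || (key y < key w)%N] by exact: sL.
    apply/setP=> w; rewrite !inE; case: eqVneq => [->|] //=.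
    by rewrite (negbTE xG) ltnNge xmin ?andbF //; apply/setDP.
suff -> : nbrs P x = [set y in P | cmp x y & (y \in G) || (key x < key y)%N].
  exact: sL.
apply/setP=> y; rewrite !inE; case yP: (y \in P) => //=.
case cxy: (cmp x y) => //=; case yG: (y \in G) => //=; apply/esym.
by rewrite ltn_neqAle keyP //= xmin //; apply/setDP; split=> //; apply/negbT.
Qed.

End CliqueComplex.

(** * Idempotents of a finite ring *)

Section FiniteRing.
Variable R : finComNzRingType.
Implicit Types a c g h y : R.

(** By pigeonhole the powers of [a] become periodic, with preperiod and period at most [#|R|]. The
    factorial of [#|R|] exceeds the former and is a multiple of the latter, whatever [a]. *)
Lemma idem_exp : exists2 n, (0 < n)%N & forall a, a ^+ n * a ^+ n = a ^+ n.
Proof.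
exists #|R|`!; first exact: fact_gt0.
move=> a.
have [i [j [ij jR aij]]] : exists i j, [/\ (i < j)%N, (j <= #|R|)%N & a ^+ i = a ^+ j].
  pose f (i : 'I_#|R|.+1) := a ^+ i.
  have /injectivePn[i [j ij fij]] : ~~ injectiveb f.
    by apply/negP => /injectiveP/leq_card; rewrite card_ord ltnn.
  have := ltn_ord i; have := ltn_ord j; rewrite !ltnS => jR iR.
  case: (ltngtP i j) => [lt|lt|/ord_inj/eqP]; last by rewrite (negbTE ij).
    by exists i, j.
  by exists j, i.
have per t d : (i <= t)%N -> a ^+ (t + d * (j - i)) = a ^+ t.
  move=> it; elim: d => [|d IH]; first by rewrite mul0n addn0.
  rewrite mulSn addnCA addnC exprD IH -{1}(subnKC it) exprD mulrAC -exprD.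
  by rewrite subnKC ?(ltnW ij) // -aij -exprD subnKC.
have dv : (j - i %| #|R|`!)%N.
  by apply: dvdn_fact; rewrite subn_gt0 ij (leq_trans (leq_subr _ _)).
have le : (i <= #|R|`!)%N.
  by apply: leq_trans (fact_geq _); apply: leq_trans jR; apply: ltnW.
by rewrite -exprD -[RHS](per _ (#|R|`! %/ (j - i))%N le) divnK.
Qed.

(** Take for [1 - g] the product over [a] in [I] of the idempotents [1 - a ^+ n], each of which
    kills [a ^+ n]; expanding it shows that [g] is in [I]. *)
Lemma ideal_idem (I : R -> Prop) : I 0 -> (forall a b, I a -> I b -> I (a + b)) ->
    (forall c a, I a -> I (c * a)) ->
  exists g n, [/\ I g, g * g = g & forall a, I a -> ((1 - g) * a) ^+ n = 0].
Proof.
move=> I0 ID IM; have [n n0 idn] := idem_exp.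
pose p := \prod_(a | `[< I a >]) (1 - a ^+ n).
have pp : p * p = p.
  rewrite /p -big_split; apply: eq_bigr => a _ /=.
  by have := idn a; set b := a ^+ n => bb; rewrite mulrBl mul1r mulrBr mulr1 bb subrr subr0.
exists (1 - p), n; split.
- rewrite /p; apply: (big_ind (fun x => I (1 - x))) => [|x y Ix Iy|a /asboolP Ia].
  + by rewrite subrr.
  + have -> : 1 - x * y = (1 - x) + x * (1 - y) by ring.
    by apply: ID => //; apply: IM.
  + by rewrite opprB addrC subrK -(prednK n0) exprSr; apply: IM.
- by rewrite mulrBl mul1r mulrBr mulr1 pp subrr subr0.
move=> a Ia; rewrite opprB addrC subrK exprMn.
have pn : p ^+ n = p by rewrite -(prednK n0); elim: n.-1 => // k IH; rewrite exprS IH.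
rewrite pn /p (bigD1 a) /=; last exact/asboolP.
by rewrite mulrAC mulrBl mul1r idn subrr mul0r.
Qed.

(** In the factor with unit [h], the element [y] differs from the unit by a nilpotent; a geometric
    series inverts it. *)
Lemma idem_sub_nil n h y :
  h * h = h -> h * y = y -> (h - y) ^+ n = 0 -> exists c, c * y = h.
Proof.
move=> hh hy nil; exists (h * \sum_(i < n) (h - y) ^+ i).
have {2}-> : y = h * (1 - (h - y)) by rewrite mulrBr mulrBr mulr1 hh hy; ring.
have /eqP := subrX1 (h - y) n; rewrite nil sub0r eq_sym => /eqP E.
rewrite mulrACA hh [X in h * X]mulrC -opprB mulNr E; ring.
Qed.

End FiniteRing.

(** * Free summands with free quotient *)

Section Pairing.
Variables (R : finComNzRingType) (n : nat).
Implicit Types (x y : 'rV[R]_n) (f : 'cV[R]_n).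

Definition pairing x f : R := (x *m f) 0 0.

Lemma pairDl x y f : pairing (x + y) f = pairing x f + pairing y f.
Proof. by rewrite /pairing mulmxDl mxE. Qed.
Lemma pairNl x f : pairing (- x) f = - pairing x f.
Proof. by rewrite /pairing mulNmx mxE. Qed.
Lemma pairZl c x f : pairing (c *: x) f = c * pairing x f.
Proof. by rewrite /pairing -scalemxAl mxE. Qed.
Lemma pairDr x f g : pairing x (f + g) = pairing x f + pairing x g.
Proof. by rewrite /pairing mulmxDr mxE. Qed.
Lemma pairNr x f : pairing x (- f) = - pairing x f.
Proof. by rewrite /pairing mulmxN mxE. Qed.
Lemma pairZr c x f : pairing x (c *: f) = c * pairing x f.
Proof. by rewrite /pairing -scalemxAr mxE. Qed.
Lemma pair0l f : pairing 0 f = 0.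
Proof. by rewrite /pairing mul0mx mxE. Qed.
Lemma pair0r x : pairing x 0 = 0.
Proof. by rewrite /pairing mulmx0 mxE. Qed.
Definition pairE := (pairDl, pairNl, pairZl, pairDr, pairNr, pairZr, pair0l, pair0r).

End Pairing.

Lemma pairM (R : finComNzRingType) m n (x : 'rV[R]_m) (A : 'M_(m, n)) f :
  pairing (x *m A) f = pairing x (A *m f).
Proof. by rewrite /pairing mulmxA. Qed.

Lemma det_col0 (R : comNzRingType) n (A : 'M[R]_n) j : (forall i, A i j = 0) -> \det A = 0.
Proof. by move=> A0; rewrite (expand_det_col A j) big1 // => i _; rewrite A0 mul0r. Qed.

Section Unimodular.
Variable R : finComNzRingType.

(** Over the factor cut out by [h], an identity of rank [a + k.+1] factors through rank [a]. Padding
    with zeros to square matrices makes the determinant vanish, while it equals a power of [h], that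
    is [h]. *)
Lemma idem_rect_eq0 a k (X : 'M[R]_(a + k.+1, a)) (Y : 'M_(a, a + k.+1)) h :
  h * h = h -> h *: 1%:M = h *: (X *m Y) -> h = 0.
Proof.
move=> hh E.
have hn m : h ^+ m.+1 = h by elim: m => // m IH; rewrite exprS IH.
have : \det (h *: 1%:M : 'M[R]_(a + k.+1)) = 0.
  rewrite E detZ.
  have -> : X *m Y = row_mx X 0 *m col_mx Y (0 : 'M_(k.+1, a + k.+1)).
    by rewrite mul_row_col mulmx0 addr0.
  rewrite det_mulmx (@det_col0 _ _ (row_mx X 0) (rshift a ord0)) ?mul0r ?mulr0 //.
  by move=> i; rewrite row_mxEr mxE.
by rewrite detZ det1 mulr1 addnS hn.
Qed.

Lemma idem_mx_nil n m (E : 'M[R]_n) :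
  E *m E = E -> (forall i j, E i j ^+ m = 0) -> E = 0.
Proof.
move=> EE nil; apply/eqP/negPn/negP => E0.
(* If [c E != 0] and [c R] is minimal, then [c (E i j) E = 0] for all [i], [j]. *)
have P1 : (1 : R) *: E != 0 by rewrite scale1r.
pose im (c : R) := [set c * x | x : R].
case: (arg_minnP (fun c : R => #|im c|) (P := fun c => c *: E != 0) P1) => c cE cmin.
have cyE i j : (c * E i j) *: E = 0.
  apply/eqP/negPn/negP => /cmin le.
  have sub : im (c * E i j) \subset im c.
    by apply/subsetP => _ /imsetP[x _ ->]; rewrite -mulrA; apply: imset_f.
  have /eqP eq : im (c * E i j) == im c by rewrite eqEcard sub.
  have : c \in im c by apply/imsetP; exists 1; rewrite ?mulr1.
  rewrite -eq => /imsetP[x _ cx].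
  have cxn d : c = c * (E i j * x) ^+ d.
    by elim: d => [|d IH]; rewrite ?mulr1 // exprS mulrA (mulrA c) -cx.
  by move: cE; rewrite (cxn m) exprMn nil mul0r mulr0 scale0r eqxx.
case/eqP: cE; rewrite -EE; apply/matrixP => i j; rewrite !mxE mulr_sumr big1 // => k _.
by have /matrixP/(_ k j) := cyE i k; rewrite !mxE mulrA.
Qed.

(* Take an idempotent [g = t f] with [Y f = 0] and [g R] as large as possible:
   over the complementary factor [(1 - g) R], the idempotent [1 - X Y] has
   nilpotent entries, so [Y] becomes invertible although it is not square. *)
Lemma unimodular_ker a b (Y : 'M[R]_(a, b)) X : Y *m X = 1%:M -> (a < b)%N ->
  exists t f, Y *m f = 0 /\ pairing t f = 1.
Proof.
move=> YX ab; have [n n0 idn] := idem_exp R.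
pose P g := g * g = g /\ exists t f, Y *m f = 0 /\ pairing t f = g.
have P0 : `[< P 0 >].
  by apply/asboolP; split; rewrite ?mul0r //; exists 0, 0; rewrite mulmx0 pair0l.
case: (arg_maxnP (fun g : R => #|[set x * g | x : R]|) (P := fun g => `[< P g >]) P0).
move=> g /asboolP[gg [t [f [Yf tf]]]] gmax.
pose h := 1 - g.
have hg : h * g = 0 by rewrite /h mulrBl mul1r gg subrr.
have hh : h * h = h by rewrite {2}/h mulrBr mulr1 hg subr0.
(* The idempotent power [e] is orthogonal to [g], and [g + e] again satisfies [P]; maximality of
   [g R] then forces [e = 0]. *)
have nil t' f' : Y *m f' = 0 -> (h * pairing t' f') ^+ n = 0.
  move=> Yf'; set y := h * pairing t' f'; set e := y ^+ n.
  have ee : e * e = e by apply: idn.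
  pose d := h * y ^+ n.-1.
  have ed : e = pairing t' f' * d.
    rewrite /e -{1}(prednK n0) exprS /y /d; ring.
  have eg : e * g = 0.
    have -> : e * g = pairing t' f' * y ^+ n.-1 * (h * g) by rewrite ed /d; ring.
    by rewrite hg mulr0.
  have Pge : `[< P (g + e) >].
    apply/asboolP; split.
      have -> : (g + e) * (g + e) = g * g + e * e + 2%:R * (e * g) by ring.
      by rewrite gg ee eg mulr0 addr0.
    exists (g *: t + (d * e) *: t'), (g *: f + e *: f'); split.
      by rewrite mulmxDr -!scalemxAr Yf Yf' !scaler0 addr0.
    rewrite !pairE tf.
    have -> : g * (g * g + e * pairing t f') + (d * e) * (g * pairing t' f + e * pairing t' f')
      = g * (g * g) + (e * g) * (pairing t f' + d * pairing t' f)
        + (e * e) * (pairing t' f' * d) by ring.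
    by rewrite !gg eg mul0r addr0 ee -ed ee.
  have sub : [set x * g | x : R] \subset [set x * (g + e) | x : R].
    apply/subsetP => _ /imsetP[x _ ->]; apply/imsetP; exists (x * g) => //.
    by rewrite mulrDr -!mulrA gg [g * e]mulrC eg mulr0 addr0.
  have /eqP eq : [set x * g | x : R] == [set x * (g + e) | x : R].
    by rewrite eqEcard sub; apply: gmax.
  have : e \in [set x * (g + e) | x : R].
    by apply/imsetP; exists e => //; rewrite mulrDr eg add0r ee.
  rewrite -eq => /imsetP[x _ ex].
  by rewrite -ee {2}ex mulrCA eg mulr0.
(* The columns of the idempotent [E] lie in the kernel of [Y], so [nil] applies to every entry of
   [h *: E]. *)
pose E := 1%:M - X *m Y.
have YE : Y *m E = 0 by rewrite mulmxBr mulmx1 mulmxA YX mul1mx subrr.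
have hE : h *: E = 0.
  apply: (@idem_mx_nil _ n) => [|i j].
    by rewrite -scalemxAl -scalemxAr scalerA hh {1}/E mulmxBl mul1mx -mulmxA YE mulmx0 subr0.
  have -> : (h *: E) i j = h * pairing (delta_mx 0 i) (col j E).
    by rewrite mxE /pairing -rowE !mxE.
  by apply: nil; rewrite colE mulmxA YE mul0mx.
have [k Eb] : exists k, b = (a + k.+1)%N by exists (b - a.+1)%N; lia.
have h0 : h = 0.
  subst b; apply: (@idem_rect_eq0 _ k X Y) => //; apply/eqP.
  by rewrite -subr_eq0 -scalerBr; apply/eqP.
by exists t, f; split=> //; rewrite tf; apply/eqP; rewrite eq_sym -subr_eq0 -/h h0.
Qed.

End Unimodular.

Section Summands.
Variables (R : finComNzRingType) (N : nat).
Local Notation vec := 'rV[R]_N.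
Implicit Types (A B V W : {set vec}) (x y l t u v : vec) (f : 'cV[R]_N).

Definition rowset k (Y : 'M[R]_(k, N)) : {set vec} := [set u *m Y | u : 'rV[R]_k].

(** A basis matrix with a right inverse encodes a free direct summand without naming a complement;
    freeness of the quotient then follows by [summand_quot]. *)
Definition summand k V := exists Y X, Y *m X = 1%:M :> 'M[R]_k /\ V = rowset Y.

Definition kills V f := forall x, x \in V -> pairing x f = 0.

Definition adjoin V l : {set vec} := [set x | [exists a : R, x - a *: l \in V]].

Lemma kills_sub V W f : V \subset W -> kills W f -> kills V f.
Proof. by move=> /subsetP VW Wf x /VW; apply: Wf. Qed.

Lemma summand_lin k V : summand k V ->
  [/\ 0 \in V, forall x y, x \in V -> y \in V -> x + y \in V
    & forall a x, x \in V -> a *: x \in V].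
Proof.
move=> [Y [X [_ ->]]]; split.
- by apply/imsetP; exists 0; rewrite ?mul0mx.
- by move=> _ _ /imsetP[x _ ->] /imsetP[y _ ->]; rewrite -mulmxDl; apply: imset_f.
- by move=> a _ /imsetP[x _ ->]; rewrite scalemxAl; apply: imset_f.
Qed.

Lemma summand_proj k V : summand k V ->
  exists Pi : 'M[R]_N, (forall x, x *m Pi \in V) /\ forall x, x \in V -> x *m Pi = x.
Proof.
move=> [Y [X [YX ->]]]; exists (X *m Y); split=> [x|_ /imsetP[u _ ->]].
  by rewrite mulmxA; apply: imset_f.
by rewrite -mulmxA (mulmxA Y) YX mul1mx.
Qed.

Lemma summand_card k V : summand k V -> #|V| = (#|R| ^ k)%N.
Proof.
move=> [Y [X [YX ->]]]; rewrite card_imset ?card_mx ?mul1n //.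
by apply: (can_inj (g := mulmx^~ X)) => u; rewrite -mulmxA YX mulmx1.
Qed.

Lemma card_gt1 : (1 < #|R|)%N.
Proof. by apply/card_gt1P; exists 0, 1; split; rewrite // eq_sym oner_neq0. Qed.

Lemma summand_leq a b A B : summand a A -> summand b B -> A \subset B -> (a <= b)%N.
Proof.
by move=> /summand_card Aa /summand_card Bb /subset_leq_card; rewrite Aa Bb leq_exp2l ?card_gt1.
Qed.

Lemma summand_ltn a b A B : summand a A -> summand b B -> A \proper B -> (a < b)%N.
Proof.
by move=> /summand_card Aa /summand_card Bb /proper_card; rewrite Aa Bb ltn_exp2l ?card_gt1.
Qed.

Lemma summand_inj a b A : summand a A -> summand b A -> a = b.
Proof.
by move=> sa sb; apply/eqP; rewrite eqn_leq !(@summand_leq _ _ A A).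
Qed.

Lemma summand_eq a A B : summand a A -> summand a B -> A \subset B -> A = B.
Proof.
move=> /summand_card Aa /summand_card Bb AB.
by apply/eqP; rewrite eqEcard AB Aa Bb leqnn.
Qed.

Lemma summand0 : summand 0 [set 0 : vec].
Proof.
exists 0, 0; split; first by apply/matrixP => -[].
apply/setP=> x; rewrite inE; apply/eqP/imsetP => [->|[u _ ->]].
  by exists 0; rewrite ?mul0mx.
by rewrite mulmx0.
Qed.

Lemma summandT : summand N [set: vec].
Proof.
exists 1%:M, 1%:M; split; first by rewrite mulmx1.
by apply/setP => x; rewrite inE; apply/esym/imsetP; exists x; rewrite ?mulmx1.
Qed.

Lemma summand_leqN k V : summand k V -> (k <= N)%N.
Proof. by move=> sV; apply: (summand_leq sV summandT); apply: subsetT. Qed.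

Lemma sub_adjoin V l : V \subset adjoin V l.
Proof.
apply/subsetP => x xV; rewrite inE; apply/existsP; exists 0.
by rewrite scale0r subr0.
Qed.

Lemma mem_adjoin k V l : summand k V -> l \in adjoin V l.
Proof.
case/summand_lin => V0 _ _; rewrite inE; apply/existsP; exists 1.
by rewrite scale1r subrr.
Qed.

Lemma adjoin_sub k V W l : summand k W -> V \subset W -> l \in W -> adjoin V l \subset W.
Proof.
case/summand_lin => _ D Z /subsetP VW lW; apply/subsetP => x; rewrite inE.
by case/existsP => a /VW xW; rewrite -[x](subrK (a *: l)); apply: D => //; apply: Z.
Qed.

Lemma kills_adjoin V l f : kills V f -> pairing l f = 0 -> kills (adjoin V l) f.
Proof.
move=> Vf lf x; rewrite inE => /existsP[a /Vf].
by rewrite !pairE lf mulr0 subr0.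
Qed.

Lemma adjoin_summand k V l f : summand k V -> kills V f -> pairing l f = 1 ->
  summand k.+1 (adjoin V l).
Proof.
move=> [Y [X [YX ->]]] Vf lf.
have Yf : Y *m f = 0.
  apply/row_matrixP => i; rewrite row0 row_mul; apply/matrixP => p q.
  by rewrite !ord1 [RHS]mxE; apply: (Vf (row i Y)); rewrite rowE; apply: imset_f.
have lf1 : l *m f = 1%:M by apply/matrixP => p q; rewrite !ord1 -/(pairing l f) lf mxE.
(* The correction by [f *m (l *m X)] makes the dual family of [Y] vanish on [l]; it stays dual to
   [Y] because [Y *m f = 0]. *)
exists (col_mx l Y), (row_mx f (X - f *m (l *m X))); split.
  apply: (eq_trans (mul_col_row l Y f _)).
  rewrite lf1 Yf !mulmxBr YX !mulmxA lf1 Yf mul1mx !mul0mx subrr subr0.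
  by rewrite -(@scalar_mx_block _ 1 k).
apply/setP => x; rewrite inE; apply/existsP/imsetP => [[a /imsetP[u _ xu]]|[u _ ->]].
  exists (row_mx a%:M u) => //.
  by rewrite (@mul_row_col _ 1 1 k) mul_scalar_mx -xu addrC subrK.
rewrite -[u](@hsubmxK _ 1 1 k) (@mul_row_col _ 1 1 k); exists (lsubmx (u : 'M_(1, 1 + k)) 0 0).
by rewrite -mul_scalar_mx -mx11_scalar addrC addKr; apply: imset_f.
Qed.

(** In the coordinates of [B], a basis of [A] is the matrix [YA *m XB], which still has a right
    inverse, and [unimodular_ker] applies. Together with [adjoin_summand] this inserts a summand of
    rank [a.+1] between [A] and [B]. *)
Lemma summand_gap a b A B : summand a A -> summand b B -> A \subset B -> (a < b)%N ->
  exists t f, [/\ t \in B, kills A f & pairing t f = 1].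
Proof.
move=> [YA [XA [YXA ->]]] [YB [XB [YXB ->]]] /subsetP AB ab.
have YAE : YA *m XB *m YB = YA.
  apply/row_matrixP => i; rewrite !row_mul.
  have /AB/imsetP[u _ ->] : row i YA \in rowset YA by rewrite rowE; apply: imset_f.
  by rewrite -[u *m YB *m XB]mulmxA YXB mulmx1.
have [|t [f [Yf tf]]] := @unimodular_ker R a b (YA *m XB) (YB *m XA) _ ab.
  by rewrite mulmxA YAE YXA.
exists (t *m YB), (XB *m f); split.
- exact: imset_f.
- by move=> _ /imsetP[u _ ->]; rewrite /pairing !mulmxA -2!mulmxA [YA *m _]mulmxA Yf mulmx0 mxE.
- by rewrite pairM mulmxA YXB mul1mx.
Qed.

End Summands.

(** * Acyclicity of intervals of summands *)

Section Nested.
Variable T : finType.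
Implicit Types A B : {set T}.

Definition nested A B := (A \proper B) || (B \proper A).

Lemma nested_sym : symmetric nested.
Proof. by move=> A B; rewrite /nested orbC. Qed.

Lemma nested_irr : irreflexive nested.
Proof. by move=> A; rewrite /nested properxx. Qed.

Lemma nested_proper A B : nested A B -> (A \proper B) = ~~ (B \proper A).
Proof. by move=> /orP[] AB; rewrite AB; move: AB; rewrite !properE => /andP[-> /negbTE->]. Qed.

Lemma nested_card A B : nested A B -> #|A| != #|B|.
Proof. by rewrite neq_ltn => /orP[] /proper_card ->; rewrite ?orbT. Qed.

Lemma proper_cardC A B : A \proper B -> (#|~: B| < #|~: A|)%N.
Proof. by move=> /proper_card; have := cardsC A; have := cardsC B; lia. Qed.

End Nested.

Lemma split_rank a w d : (a < w -> w < a + d.+1 -> exists d1 d2,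
  [/\ w = a + d1.+1, a + d.+1 = w + d2.+1, d.-1 = d2 + d1, d1 < d & d2 < d])%N.
Proof. by move=> aw wb; exists (w - a.+1)%N, (a + d - w)%N; split; lia. Qed.

Section Interval.
Variables (R : finComNzRingType) (N : nat).
Local Notation vec := 'rV[R]_N.
Implicit Types (A B V W : {set vec}) (x y l t u v k m : vec) (f : 'cV[R]_N) (e h : R).

(* With [v = 0] and [e = 0] these are all the summands strictly between [A]
   and [B]; with [e = 1], those meeting the line spanned by [v] in general
   position.  An idempotent [e] lets the condition bear on some of the local
   factors of [R] only. *)
Definition avoiding A B v e : {set {set vec}} :=
  [set W | `[< [/\ exists i, summand i W, A \proper W, W \proper B
              & exists f, kills W f /\ pairing v f = e] >]].

Lemma avoidingP A B v e W : reflect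
  [/\ exists i, summand i W, A \proper W, W \proper B
              & exists f, kills W f /\ pairing v f = e] (W \in avoiding A B v e).
Proof. by rewrite inE; apply: asboolP. Qed.

(** Says that the vector [m] is unimodular modulo [V + R k]. *)
Definition separated V k m := exists f, [/\ kills V f, pairing k f = 0 & pairing m f = 1].

(* [h] cuts out the factors of [R] over which [m] lies in [W + R k] modulo
   nilpotents, and [u] is the component of [h m] in [W]. *)
Lemma separated_avoiding W k m (Pi : 'M[R]_N) :
    (forall x, x *m Pi \in W) -> (forall x, x \in W -> x *m Pi = x) -> k *m Pi = 0 ->
  exists u h, [/\ u \in W, h * h = h, h *: u = u
    & forall V, V \subset W ->
       separated V k m <-> exists f, kills V f /\ pairing u f = h].
Proof.
move=> PiW PiK kPi.
pose I a := exists f, [/\ kills W f, pairing k f = 0 & pairing m f = a].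
have [||c a [f [Wf kf <-]]|g [n [[f0 [Wf0 kf0 mf0]] gg nil]]] := @ideal_idem R I.
- by exists 0; split=> [x _||]; rewrite pair0r.
- move=> a b [f [Wf kf <-]] [f' [Wf' kf' <-]]; exists (f + f').
  by split=> [x xW||]; rewrite pairDr ?(Wf _ xW) ?(Wf' _ xW) ?kf ?kf' ?addr0.
- by exists (c *: f); split=> [x xW||]; rewrite pairZr ?(Wf _ xW) ?kf ?mulr0.
pose h := 1 - g.
have hh : h * h = h by rewrite /h mulrBl mul1r mulrBr mulr1 gg subrr subr0.
exists (h *: (m *m Pi)), h; split=> //.
- by rewrite scalemxAl; apply: PiW.
- by rewrite scalerA hh.
move=> V VW; split=> [[f [Vf kf mf]]|[f [Vf uf]]].
  set y := pairing (h *: (m *m Pi)) f.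
  (* The form [f - Pi *m f] kills [W] and [k], so its value at [m] lies in [I] and is nilpotent over
     [h]; hence [y] is a unit over [h]. *)
  have [||c cy] := @idem_sub_nil R n h y hh.
  - by rewrite /y pairZl mulrA hh.
  - have -> : h - y = (1 - g) * pairing m (f - Pi *m f).
      by rewrite !pairE mf -pairM /y pairZl mulrBr mulr1.
    apply: nil; exists (f - Pi *m f); split=> // [x xW|].
      by rewrite !pairE -pairM PiK // subrr.
    by rewrite !pairE -pairM kPi kf pair0l subrr.
  exists (c *: f); split=> [x xV|]; first by rewrite pairZr Vf ?mulr0.
  by rewrite pairZr.
(* Two forms are glued: over [h], the form [f] after projection, which kills [k]; over [g], the form
   [f0], which kills all of [W]. *)
exists (h *: (Pi *m f) + g *: f0); split=> [x xV||]; rewrite !pairE -pairM.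
- have xW := subsetP VW x xV.
  by rewrite PiK // Vf // Wf0 // !mulr0 addr0.
- by rewrite kPi pair0l kf0 !mulr0 addr0.
- by rewrite -pairZl uf mf0 gg subrK.
Qed.

Lemma ltn_proper a b A B : summand a A -> summand b B -> A \subset B -> (a < b)%N ->
  A \proper B.
Proof.
move=> sA sB AB ab; rewrite properEneq AB andbT; apply: contraTneq ab => E.
by rewrite E in sA; rewrite (summand_inj sA sB) ltnn.
Qed.

Lemma notin_pair V x f : kills V f -> pairing x f = 1 -> x \notin V.
Proof.
move=> Vf xf; apply: contra_eqN xf => /Vf ->; rewrite eq_sym; exact: oner_neq0.
Qed.

(** [d] counts the ranks strictly between those of [A] and [B], so the complex has dimension at most
    [d - 1]. The form [f] says that [A] itself satisfies the condition put on [W]. *)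
Definition interval_spherical d := forall a A B v e f,
  summand a A -> summand (a + d.+1) B -> A \subset B -> e * e = e -> e *: v = v ->
  v \in B -> kills A f -> pairing v f = e ->
  spherical (@nested _) d (avoiding A B v e).

(** The attaching step, used twice: with [G] conically contractible and [k] on the fixed line, then
    with [G] the summands in general position to that line and [k = 0]. By [separated_avoiding] the
    part of [G] below [W] is an [avoiding A W u h]. *)
Lemma avoiding_attach d a A B v e (G : {set {set vec}}) k m :
    (forall d', (d' < d)%N -> interval_spherical d') ->
    summand a A -> summand (a + d.+1) B -> A \subset B ->
    e * e = e -> e *: v = v -> v \in B ->
    G \subset avoiding A B v e -> spherical (@nested _) d G -> separated A k m ->
    (forall W, W \in avoiding A B v e -> W \notin G ->
      (exists Pi : 'M[R]_N, [/\ forall x, x *m Pi \in W,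
         forall x, x \in W -> x *m Pi = x & k *m Pi = 0]) /\
      (forall V, V \in avoiding A B v e -> V \proper W ->
         V \in G <-> separated V k m)) ->
  spherical (@nested _) d (avoiding A B v e).
Proof.
move=> IH sA sB AB ee ev vB GP sG sepA HW.
apply: (spherical_attach (key := fun W => #|W|) GP _ sG).
  by move=> V W; apply: nested_card.
move=> W WP WG; have [[Pi [PiW PiK kPi]] VG] := HW W WP WG.
have [u [h [uW hh hu sepE]]] := separated_avoiding m PiW PiK kPi.
have /avoidingP[[w sW] AW WB [f [Wf vf]]] := WP.
have aw := summand_ltn sA sW AW; have wb := summand_ltn sW sB WB.
have [d1 [d2 [Ew Eb -> d1d d2d]]] := split_rank aw wb.
(* Above [W] everything is already present. Below [W] only [G] is, and there the condition on [v] is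
   automatic, since a form that kills [W] kills every smaller summand. *)
have -> : [set V in avoiding A B v e | nested W V & (V \in G) || (#|W| < #|V|)%N]
    = avoiding W B v e :|: avoiding A W u h.
  apply/setP => V; rewrite in_set in_setU; apply/idP/idP.
    case/andP=> VP; have /avoidingP[sV AV VB fV] := VP.
    case/andP=> /orP[WV _|VW]; first by apply/orP; left; apply/avoidingP.
    rewrite ltnNge (ltnW (proper_card VW)) orbF => /(VG V VP VW) sep.
    apply/orP; right; apply/avoidingP; split=> //.
    by apply/(sepE V) => //; apply: proper_sub.
  case/orP=> /avoidingP[sV AV VB fV].
    have -> : V \in avoiding A B v e by apply/avoidingP; split=> //; apply: proper_trans AV.
    by rewrite /nested AV (proper_card AV) orbT.
  have VP : V \in avoiding A B v e.
    apply/avoidingP; split=> //; first exact: proper_trans VB WB.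
    by exists f; split=> //; apply: kills_sub Wf; apply: proper_sub.
  rewrite VP /nested VB orbT /=; apply/orP; left.
  by apply/(VG V VP VB)/sepE => //; apply: proper_sub.
apply: (spherical_join (@nested_irr _)).
- move=> V V' /avoidingP[_ WV _ _] /avoidingP[_ _ VW _].
  by rewrite /nested (proper_trans VW WV) orbT.
- apply: (IH d2 _ w W B v e f) => //; rewrite -?Eb //.
  exact: proper_sub.
- have [g [Ag ug]] := (sepE A (proper_sub AW)).1 sepA.
  apply: (IH d1 _ a A W u h g) => //; rewrite -?Ew //.
  exact: proper_sub.
Qed.

(** A second vector [m], independent of [l] modulo [A], provides contractions by adding [m];
    separation modulo [l] is what keeps [W + R m] in general position to [l]. *)
Lemma line_spherical d a A B l f :
    (forall d', (d' < d)%N -> interval_spherical d') ->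
    summand a A -> summand (a + d.+1) B -> A \subset B ->
    l \in B -> kills A f -> pairing l f = 1 ->
  spherical (@nested _) d (avoiding A B l 1).
Proof.
move=> IH sA sB AB lB Af lf.
(* For [d = 0] there is no room for [m] outside [A + R l], and nothing to prove. *)
case: d IH sB => [|d] IH sB; first exact: Spherical0.
have sAl := adjoin_summand sA Af lf.
have lt : (a.+1 < a + d.+2)%N by rewrite !addnS !ltnS leq_addr.
have [m [c [mB Alc mc]]] := summand_gap sAl sB (adjoin_sub sB AB lB) lt.
have Ac : kills A c by apply: kills_sub Alc; apply: sub_adjoin.
have lc : pairing l c = 0 by apply: Alc; apply: mem_adjoin sA.
set P := avoiding A B l 1.
pose G0 := [set W in P | m \in W].
pose G := [set W in P | (m \in W) || `[< separated W l m >]].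
have sepP W : separated W l m -> m \notin W.
  by move=> [g [Wg _ mg]]; apply: notin_pair Wg mg.
have adjP W g : W \in P -> kills W g -> pairing l g = 0 -> pairing m g = 1 ->
    adjoin W m \in P.
  move=> /avoidingP[[w sW] AW WB [g1 [Wg1 lg1]]] Wg lg mg.
  have kW : kills (adjoin W m) (g1 - pairing m g1 *: g).
    apply: kills_adjoin => [x xW|]; rewrite !pairE ?mg ?mulr1 ?subrr //.
    by rewrite Wg1 // Wg // mulr0 subrr.
  have lW : pairing l (g1 - pairing m g1 *: g) = 1 by rewrite !pairE lg mulr0 subr0.
  apply/avoidingP; split.
  - by exists w.+1; apply: adjoin_summand Wg mg.
  - by apply: proper_sub_trans AW _; apply: sub_adjoin.
  - apply/properP; split; first by apply: adjoin_sub => //; [exact: sB|exact: proper_sub].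
    by exists l => //; apply: notin_pair kW lW.
  - by exists (g1 - pairing m g1 *: g).
(* [G] is conically contractible: [W <= W + R m >= A + R m]. *)
have sG : spherical (@nested _) d.+1 G.
  (* With the size of the complement as key, members of [G] without [m] are added by increasing
     size: the link of [W] has all of [G] below [W], and above it only summands containing [m]. *)
  apply: (@spherical_attach _ _ (fun W => #|~: W|) d.+1 G0).
  - by apply/subsetP => W; rewrite !inE => /andP[-> ->].
  - by move=> V W /orP[] /proper_cardC; rewrite neq_ltn => ->; rewrite ?orbT.
  - apply: (@SphericalCone _ _ _ _ (adjoin A m)).
      rewrite in_set (mem_adjoin _ sA) andbT.
      apply/avoidingP; split.
      + by exists a.+1; apply: adjoin_summand Ac mc.
      + apply/properP; split; first exact: sub_adjoin.
        by exists m; [exact: mem_adjoin sA|exact: notin_pair Ac mc].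
      + apply: (ltn_proper (adjoin_summand sA Ac mc) sB _ lt).
        exact: adjoin_sub sB _ _.
      + exists (f - pairing m f *: c); split.
          apply: kills_adjoin => [x xA|]; rewrite !pairE ?mc ?mulr1 ?subrr //.
          by rewrite Af // Ac // mulr0 subrr.
        by rewrite !pairE lf lc mulr0 subr0.
    move=> W; rewrite in_set => /andP[/avoidingP[[w sW] AW _ _] mW] WA.
    by rewrite /nested properEneq eq_sym WA (adjoin_sub sW) ?proper_sub.
  move=> W; rewrite in_set => /andP[WP mW]; rewrite in_set WP /= => mW'.
  move: mW; rewrite (negbTE mW') /= => /asboolP[g [Wg lg mg]].
  have /avoidingP[[w sW] AW WB [g1 [Wg1 lg1]]] := WP.
  have Wm : W \proper adjoin W m.
    apply/properP; split; first exact: sub_adjoin.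
    by exists m => //; apply: mem_adjoin sW.
  (* The apex [W + R m] contains what lies below [W] and is contained in every summand above [W]
     through [m]. *)
  apply: (@SphericalCone _ _ _ _ (adjoin W m)).
    have WmG0 : adjoin W m \in G0 by rewrite in_set (adjP W g) // (mem_adjoin _ sW).
    have WmG : adjoin W m \in G by rewrite in_set (adjP W g) // (mem_adjoin _ sW).
    by rewrite in_set WmG WmG0 /nested Wm.
  move=> V; rewrite in_set => /andP[VG /andP[cWV H]] neq.
  have mWV : m \in V -> W \proper V.
    move=> mV; case/orP: cWV => // /proper_sub/subsetP/(_ m mV).
    by rewrite (negbTE mW').
  have [/andP[VP mV]|] := boolP ((V \in P) && (m \in V)).
    have /avoidingP[[i sV] _ _ _] := VP.
    by rewrite /nested properEneq eq_sym neq (adjoin_sub sV) // proper_sub // mWV.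
  move=> nV; move: H; rewrite [V \in G0]in_set (negbTE nV) /= => key.
  case/orP: cWV => [/proper_cardC/ltnW|VW]; first by rewrite leqNgt key.
  by rewrite /nested (proper_trans VW Wm) orbT.
apply: (avoiding_attach IH sA sB AB _ _ lB (G := G) (k := l) (m := m)) => //.
- by rewrite mulr1.
- by rewrite scale1r.
- by apply/subsetP => W; rewrite inE => /andP[].
- by exists c.
move=> W WP; rewrite in_set WP /= negb_or => /andP[mW _].
have /avoidingP[[w sW] AW WB [g [Wg lg]]] := WP.
split.
  have [Pi [PiW PiK]] := summand_proj sW.
  (* Removing the component [pairing x g] along [l] before projecting makes the projection vanish at
     [l]; nothing changes on [W], which [g] kills. *)
  exists ((1%:M - g *m l) *m Pi).
  have gE x : x *m (g *m l) = pairing x g *: l.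
    by rewrite mulmxA [x *m g]mx11_scalar mul_scalar_mx.
  split=> [x|x xW|]; rewrite mulmxA ?PiW // mulmxBr mulmx1 gE.
    by rewrite Wg // scale0r subr0 PiK.
  by rewrite lg scale1r subrr mul0mx.
move=> V VP VW; rewrite in_set VP /=; split=> [/orP[mV|/asboolP//]|sep].
  by rewrite (subsetP (proper_sub VW)) in mW.
by apply/orP; right; apply/asboolP.
Qed.

(** On the factors where [e] vanishes, [t] completes [v] to a vector [l] unimodular modulo [A].
    Since [v = e *: l], general position to [l] implies the condition on [v], and [line_spherical]
    gives the starting family. *)
Theorem avoiding_spherical d : interval_spherical d.
Proof.
elim/ltn_ind: d => d IH a A B v e f sA sB AB ee ev vB Af vf.
have lt : (a < a + d.+1)%N by rewrite addnS ltnS leq_addr.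
have [t [c [tB Ac tc]]] := summand_gap sA sB AB lt.
pose l := v + (1 - e) *: t.
have [_ BD BZ] := summand_lin sB.
have lB : l \in B by apply: BD => //; apply: BZ.
pose g := e *: f + (1 - e) *: c.
have Ag : kills A g by move=> x xA; rewrite !pairE Af // Ac // !mulr0 addr0.
have lg : pairing l g = 1.
  rewrite !pairE vf tc -ev pairZl.
  transitivity (1 + (e * e - e) * (1 + pairing v c * - 1 - pairing t f + 1)); first by ring.
  by rewrite ee subrr mul0r addr0.
have el : e *: l = v by rewrite scalerDr ev scalerA mulrBr mulr1 ee subrr scale0r addr0.
have sG := line_spherical IH sA sB AB lB Ag lg.
apply: (avoiding_attach IH sA sB AB ee ev vB (k := 0) (m := l) _ sG) => //.
- apply/subsetP => W /avoidingP[sW AW WB [f' [Wf' lf']]].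
  apply/avoidingP; split=> //; exists f'; split=> //.
  by rewrite -el pairZl lf' mulr1.
- by exists g; rewrite pair0l.
move=> W /avoidingP[[w sW] AW WB fW] _; split.
  have [Pi [PiW PiK]] := summand_proj sW.
  by exists Pi; rewrite mul0mx.
move=> V /avoidingP[sV AV VB fV] VW; split.
  by case/avoidingP=> _ _ _ [f' [Vf' lf']]; exists f'; rewrite pair0l.
by case=> f' [Vf' _ lf']; apply/avoidingP; split=> //; exists f'.
Qed.

End Interval.

(** * Betti number and Euler characteristic *)

Section Betti.
Variables (X : finType) (cmp lt : rel X) (P : {set X}).
Hypothesis lt_irr : irreflexive lt.
Hypothesis lt_cmp : forall x y, cmp x y -> lt x y = ~~ lt y x.
Hypothesis cmp_sym : symmetric cmp.
Implicit Types (S T : {set X}).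

Definition cliques : {set {set X}} := [set S : {set X} | (S \subset P) && clique cmp S].

(* The sign rules only need an asymmetric and total relation, not an order. *)
Definition tournament x y :=
  if cmp x y then lt x y else (enum_rank x < enum_rank y)%N.

Lemma tournamentP x y : x != y -> tournament x y = ~~ tournament y x.
Proof.
move=> xy; rewrite /tournament cmp_sym; case: ifP => [yx|_].
  by apply: lt_cmp; rewrite cmp_sym.
rewrite -leqNgt ltn_neqAle; case: eqVneq => //= /ord_inj/enum_rank_inj E.
by rewrite E eqxx in xy.
Qed.

Local Notation faces := (faces_sz cliques).
Local Notation d := (bd tournament).

Lemma facesP S m :
  reflect [/\ S \subset P, clique cmp S & #|S| = m] (S \in faces m).
Proof.
rewrite !inE; apply: (iffP andP) => [[/andP[-> ->] /eqP]|[-> -> ->]] //.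
Qed.

Definition chain m (z : 'rV[rat]_#|faces m|) S : rat :=
  \sum_i z 0 i * (enum_val i == S)%:R.

Lemma chain_val m (z : 'rV_#|faces m|) j : chain z (enum_val j) = z 0 j.
Proof.
rewrite /chain (bigD1 j) //= eqxx mulr1 big1 ?addr0 // => i ij.
by rewrite (inj_eq enum_val_inj) (negbTE ij) mulr0.
Qed.

Lemma chain_out m (z : 'rV_#|faces m|) S : S \notin faces m -> chain z S = 0.
Proof.
move=> SF; rewrite /chain big1 // => i _; case: eqP => [E|_]; rewrite ?mulr0 //.
by rewrite -E enum_valP in SF.
Qed.

Lemma chain_supp m (z : 'rV_#|faces m|) : supported cmp P m (chain z).
Proof. by move=> S zS; apply/facesP; apply: contra_neqT zS; apply: chain_out. Qed.

Lemma chain_row m (w : {set X} -> rat) : supported cmp P m w ->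
  chain (\row_(j < #|faces m|) w (enum_val j)) =1 w.
Proof.
move=> sw S; have [SF|SF] := boolP (S \in faces m).
  by rewrite -(enum_rankK_in SF SF) chain_val mxE.
rewrite chain_out //; apply/esym/eqP; apply: contraNT SF => /sw wS.
exact/facesP.
Qed.

Lemma chain_inj m (z w : 'rV_#|faces m|) : chain z =1 chain w -> z = w.
Proof.
by move=> zw; apply/rowP => j; rewrite -!chain_val.
Qed.

(** The vertices of a face are pairwise related by [cmp], where [tournament] agrees with [lt], so
    both boundaries have the same signs. *)
Lemma bd_coefE p S T : S \in faces p.+1 -> T \in faces p ->
  bd_coef lt S T = \sum_(x | x \notin T) sgn tournament x T * (S == x |: T)%:R.
Proof.
move=> /facesP[_ /cliqueP cS cardS] /facesP[_ _ cardT]; rewrite /bd_coef.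
case: ifPn => [TS|nTS]; last first.
  rewrite big1 // => x _; case: eqP => [E|]; rewrite ?mulr0 //.
  by rewrite E subsetUr in nTS.
have /eqP/cards1P[a SDT] : #|S :\: T| = 1%N.
  by rewrite cardsD (setIidPr TS) cardS cardT subSnn.
have aST : a \in S :\: T by rewrite SDT set11.
have /setDP[aS aT] := aST.
have SE : S = a |: T by rewrite -SDT setUC -{1}(setIidPr TS) setID.
rewrite SDT; case: pickP => [x|/(_ a)]; last by rewrite set11.
rewrite inE => /eqP->; rewrite (bigD1 a) //= -SE eqxx mulr1 big1 ?addr0.
  rewrite /sgn; congr (_ ^+ #|pred_of_set _|); apply/setP => w; rewrite !inE.
  rewrite {1}SE !inE; case: eqVneq => [->|wa] /=.
    by rewrite lt_irr (negbTE aT).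
  case wT: (w \in T) => //=; rewrite /tournament cS //.
  exact: (subsetP TS).
move=> y /andP[yT ya]; case: eqP => [E|]; rewrite ?mulr0 //.
have : y \in S by rewrite E setU11.
by rewrite SE !inE (negbTE ya) (negbTE yT).
Qed.

Lemma bd_out m w T : supported cmp P m.+1 w -> T \notin faces m -> d w T = 0.
Proof.
move=> sw TF; rewrite /bd big1 // => x xT; apply/eqP; rewrite mulf_eq0.
apply/orP; right; apply: contraNT TF => /sw[].
rewrite subUset => /andP[_ TP] cxT; rewrite cardsU1 xT => -[cardT].
by apply/facesP; split=> //; apply: sub_clique cxT; apply: subsetUr.
Qed.

Lemma chain_bd p (z : 'rV_#|faces p.+1|) :
  chain (z *m bd_mx cliques lt p) =1 d (chain z).
Proof.
move=> T; have [TF|TF] := boolP (T \in faces p); last first.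
  by rewrite chain_out // (bd_out (@chain_supp _ z)).
rewrite -(enum_rankK_in TF TF) chain_val mxE /bd.
under [RHS]eq_bigr do rewrite mulr_sumr.
rewrite exchange_big /=; apply: eq_bigr => i _.
rewrite mxE (@bd_coefE p) ?enum_valP // mulr_sumr.
by apply: eq_bigr => x _; rewrite mulrCA.
Qed.

Lemma exact_sub m (z : 'rV_#|faces m|) : exact_at cmp tournament P m ->
  (forall T, d (chain z) T = 0) -> (z <= bd_mx cliques lt m)%MS.
Proof.
move=> ex /(ex _ (@chain_supp _ z))[w sw dw].
suff -> : z = (\row_(j < #|faces m.+1|) w (enum_val j)) *m bd_mx cliques lt m.
  exact: submxMl.
by apply: chain_inj => T; rewrite chain_bd -dw; apply/esym/eq_bd/chain_row.
Qed.

Definition rank_bd m := if m is p.+1 then \rank (bd_mx cliques lt p) else 0%N.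

(** Rank-nullity: [bd_bd] gives one inequality, and exactness, putting the kernel inside the next
    image, gives the other. *)
Lemma exact_rank m : exact_at cmp tournament P m ->
  (rank_bd m + rank_bd m.+1 = #|faces m|)%N.
Proof.
case: m => [|p] ex /=; last first.
  apply/eqP; rewrite eqn_leq addnC mulmx0_rank_max /=; last first.
    apply/row_matrixP => i; rewrite row0 rowE mulmxA; apply: chain_inj => T.
    rewrite chain_bd (eq_bd _ (chain_bd _)) bd_bd; last exact: tournamentP.
    by rewrite /chain big1 // => j _; rewrite mxE mul0r.
  rewrite addnC -leq_subLR -mxrank_ker; apply/mxrankS/row_subP => i.
  apply: exact_sub => // T; rewrite -chain_bd.
  have -> : row i (kermx (bd_mx cliques lt p)) *m bd_mx cliques lt p = 0.
    by rewrite -row_mul mulmx_ker row0.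
  by rewrite /chain big1 // => j _; rewrite mxE mul0r.
rewrite add0n; apply/eqP; rewrite eqn_leq rank_leq_col -[X in (X <= _)%N](mxrank1 rat).
apply/mxrankS/row_subP => i; apply: exact_sub => // T.
rewrite /bd big1 // => x _; rewrite chain_out ?mulr0 //.
by apply/negP => /facesP[_ _ /eqP]; rewrite cards_eq0 => /eqP/setP/(_ x); rewrite !inE eqxx.
Qed.

Lemma rank_bd_leq m : (rank_bd m <= #|faces m|)%N.
Proof. by case: m => //= p; apply: rank_leq_row. Qed.

Lemma rank_bd_euler m : (forall k, (k < m)%N -> exact_at cmp tournament P k) ->
  ((-1) ^+ m * (rank_bd m)%:Z = - \sum_(k < m) (-1) ^+ k * #|faces k|%:Z)%R.
Proof.
elim: m => [|m IH] ex; first by rewrite big_ord0 oppr0 mulr0.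
rewrite big_ord_recr /= opprD -IH => [|k km]; last exact/ex/ltnW.
have := exact_rank (ex m (leqnn _)) => /= E.
by rewrite -[X in _ - _ * X%:Z]E PoszD exprS; ring.
Qed.

(** Exactness below degree [m] determines the ranks from the face numbers, and no boundary comes
    from above; the top Betti number is what remains of the alternating sum. *)
Lemma betti_euler m : (forall k, (k < m)%N -> exact_at cmp tournament P k) ->
    (forall S, S \in cliques -> (#|S| <= m)%N) ->
  ((red_betti cliques lt m)%:Z = (-1) ^+ m * \sum_(S in cliques) (-1) ^+ #|S|)%R.
Proof.
move=> ex top.
have f0 : #|faces m.+1| = 0%N.
  apply/eqP; rewrite cards_eq0 -subset0; apply/subsetP => S; rewrite inE.
  by case/andP => /top; rewrite leqNgt => /negP H /eqP E; case: H; rewrite E.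
have r0 : \rank (bd_mx cliques lt m) = 0%N.
  by apply/eqP; rewrite -leqn0 -f0 rank_leq_row.
have -> : red_betti cliques lt m = (#|faces m| - rank_bd m)%N.
  by rewrite /red_betti r0 subn0.
rewrite -subzn ?rank_bd_leq //.
have -> : \sum_(S in cliques) (-1) ^+ #|S| = \sum_(k < m.+1) (-1) ^+ k * #|faces k|%:Z :> int.
  rewrite (partition_big (fun S => inord #|S| : 'I_m.+1) xpredT) //=.
  apply: eq_bigr => k _; rewrite -sum1_card -natz natr_sum mulr_sumr.
  apply: eq_big => [S|S /andP[SF /eqP <-]]; last first.
    by rewrite mulr1 inordK // ltnS top.
  rewrite !inE; apply: andb_id2l => SF.
  have mS : (#|S| < m.+1)%N by rewrite ltnS top // inE.
  by apply/eqP/eqP => [<-|E]; [rewrite inordK|apply: val_inj; rewrite /= inordK].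
have E : \sum_(k < m) (-1) ^+ k * #|faces k|%:Z = - ((-1) ^+ m * (rank_bd m)%:Z) :> int.
  by rewrite rank_bd_euler // opprK.
rewrite big_ord_recr /= E mulrDr mulrN !mulrA -expr2 sqrr_sign !mul1r.
by rewrite addrC.
Qed.

End Betti.

(** * Flags of summands *)

Section Translation.
Variables (R : finComNzRingType) (n : nat).
Local Notation vec := 'rV[R]_n.
Implicit Types (V W : {set vec}) (S C : {set {set vec}}).

Lemma summandP k V : summand k V <-> direct_summand V /\ free_rank V k.
Proof.
split=> [sV|[[[V0 [VD VZ]] [W [[_ [WD WZ]] [VW dec]]]] [B [Binj VB]]]].
  have [V0 VD VZ] := summand_lin sV; have [Y [X [YX VE]]] := sV.
  split; last by exists Y; split=> // u uY; rewrite -[u]mulmx1 -YX mulmxA uY mul0mx.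
  split=> //; exists [set x | x *m X == 0]; split; last split.
  - split; [by rewrite inE mul0mx|split=> [u v|a v]; rewrite !inE].
      by move=> /eqP uX /eqP vX; rewrite mulmxDl uX vX addr0.
    by move=> /eqP vX; rewrite -scalemxAl vX scaler0.
  - apply/setP => x; rewrite !inE VE; apply/andP/eqP => [[/imsetP[u _ ->]]|->].
      by rewrite -mulmxA YX mulmx1 => /eqP->; rewrite mul0mx.
    by rewrite mul0mx eqxx -VE.
  - move=> x; exists (x *m X *m Y), (x - x *m X *m Y); split.
      by rewrite VE; apply: imset_f.
    by rewrite inE mulmxBl -[x *m X *m Y *m X]mulmxA YX mulmx1 subrr eqxx addrC subrK.
have VN x : x \in V -> - x \in V by move=> xV; rewrite -scaleN1r; apply: VZ.
have WN x : x \in W -> - x \in W by move=> xW; rewrite -scaleN1r; apply: WZ.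
(* [X i] holds the coordinates of the [V]-component of a standard vector, so [M] is the projection
   along [W] written in the basis [B]. *)
have /choice[X XW] (i : 'I_n) : exists x : 'rV[R]_k, delta_mx 0 i - x *m B \in W.
  have [v [w [+ [wW E]]]] := dec (delta_mx 0 i); rewrite VB => /imsetP[x _ xv].
  by exists x; rewrite E xv addrC addKr.
pose M : 'M[R]_(n, k) := \matrix_i X i.
have decM x : x - x *m M *m B \in W.
  have -> : x - x *m M *m B = \sum_i x 0 i *: (delta_mx 0 i - X i *m B).
    rewrite {1 2}[x]row_sum_delta !mulmx_suml -sumrB; apply: eq_bigr => i _.
    by rewrite -!scalemxAl -rowE rowK scalerBr scalemxAl.
  elim/big_ind: _ => [|x1 x2|i _]; [|exact: WD|exact: WZ].
  by have [_ [w [_ [wW _]]]] := dec 0; rewrite -(scale0r w); apply: WZ.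
exists B, M; split=> //.
apply/row_matrixP => i; rewrite !rowE mulmx1 mulmxA; apply/eqP; rewrite eq_sym -subr_eq0.
apply/eqP/Binj; apply/eqP; rewrite mulmxBl -in_set1 -VW inE decM andbT VB -mulmxBl.
exact: imset_f.
Qed.

(** Induction on the corank: [summand_gap] gives a unimodular vector [t] of the quotient, to which a
    basis modulo [V + R t] is appended. *)
Lemma summand_quot m k V : summand k V -> (n = k + m)%N -> quot_free_rank V m.
Proof.
elim: m k V => [|m IH] k V sV E.
  have VT : V = setT.
    rewrite addn0 in E; rewrite -E in sV.
    exact: summand_eq sV (summandT R n) (subsetT V).
  exists 0; split=> [u _|x]; first by apply/rowP => -[].
  by exists 0; rewrite VT inE.
have lt : (k < n)%N by rewrite E addnS ltnS leq_addr.
have [t [f [_ Vf tf]]] := summand_gap sV (summandT R n) (subsetT V) lt.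
have sW := adjoin_summand sV Vf tf.
have [|C [Cinj Cgen]] := IH _ _ sW; first by rewrite E addSnnS.
have [V0 VD VZ] := summand_lin sV.
exists (col_mx t C : 'M_(1 + m, n)); split=> [u|x].
  rewrite -[u](@hsubmxK _ 1 1 m) (@mul_row_col _ 1 1 m).
  rewrite [X in X *m t]mx11_scalar mul_scalar_mx.
  set a := lsubmx _ 0 0; set v := rsubmx _ => uV.
  have v0 : v = 0.
    by apply: Cinj; rewrite inE; apply/existsP; exists (- a); rewrite scaleNr opprK addrC.
  move: uV; rewrite v0 mul0mx addr0 => /Vf; rewrite pairE tf mulr1 => a0.
  rewrite [X in row_mx X _]mx11_scalar -/a a0.
  by rewrite raddf0 row_mx0.
have [v] := Cgen x; rewrite inE => /existsP[a xV].
exists (row_mx a%:M v : 'M_(1, 1 + m)).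
by rewrite (@mul_row_col _ 1 1 m) mul_scalar_mx opprD addrA addrAC.
Qed.

Lemma GrassP k V : reflect (summand k V) (V \in Grass R n k).
Proof.
rewrite inE; apply: (iffP (asboolP _)) => [[dV [fV _]]|sV]; first exact/summandP.
have [dV fV] := (summandP k V).1 sV; split=> //; split=> //.
exists (n - k)%N; apply: (summand_quot sV); rewrite subnKC //.
exact: summand_leqN sV.
Qed.

Definition vertices := avoiding [set 0 : vec] setT 0 0.

Lemma verticesP V :
  reflect [/\ exists k, summand k V, V != [set 0] & V != setT] (V \in vertices).
Proof.
apply: (iffP (avoidingP _ _ _ _ _)) => [[sV V0 VT _]|[[k sV] V0 VT]].
  by split=> //; rewrite ?(proper_neq VT) // eq_sym (proper_neq V0).
split; first by exists k.
- by rewrite properEneq eq_sym V0 sub1set; case: (summand_lin sV).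
- by rewrite properEneq VT subsetT.
- by exists 0; split=> [x _|]; rewrite pair0r.
Qed.

Lemma vertices_rank k V : summand k V -> (V \in vertices) = (0 < k < n)%N.
Proof.
move=> sV; apply/verticesP/andP => [[_ V0 VT]|[k0 kn]].
  split.
    rewrite lt0n; apply: contraNneq V0 => k0; rewrite k0 in sV.
    rewrite eq_sym; apply/eqP; apply: (summand_eq (summand0 R n) sV).
    by rewrite sub1set; case: (summand_lin sV).
  by rewrite (summand_ltn sV (summandT R n)) // properEneq VT subsetT.
split; first by exists k.
- by apply: contraTneq k0 => E; rewrite E in sV; rewrite (summand_inj sV (summand0 R n)).
- by apply: contraTneq kn => E; rewrite E in sV; rewrite (summand_inj sV (summandT R n)) ltnn.
Qed.

Definition rk V := trunc_log #|R| #|V|.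

Lemma rk_summand k V : summand k V -> rk V = k.
Proof. by move/summand_card=> E; rewrite /rk E trunc_expnK // card_gt1. Qed.

Lemma rk_vertex V : V \in vertices -> summand (rk V) V /\ (0 < rk V < n)%N.
Proof.
move=> VP; have /verticesP[[k sV] _ _] := VP; rewrite (rk_summand sV); split=> //.
by rewrite -(vertices_rank sV).
Qed.

Local Notation chains := (cliques (@nested _) vertices).

Lemma chainsP S : reflect (S \subset vertices /\
  forall V W, V \in S -> W \in S -> V \subset W \/ W \subset V) (S \in chains).
Proof.
rewrite inE; apply: (iffP andP) => [[SP /cliqueP cS]|[SP cS]]; split=> //.
  move=> V W VS WS; have [->|VW] := eqVneq V W; first by left.
  by have /orP[] := cS V W VS WS VW => /proper_sub; [left|right].
apply/cliqueP => V W VS WS VW; rewrite /nested !properEneq VW eq_sym VW /=.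
by apply/orP; apply: cS.
Qed.

Lemma chain_card S : S \in chains -> (#|S| <= n.-1)%N.
Proof.
move=> /[dup] SC /chainsP[/subsetP SP cS].
have [->|[V0 V0S]] := set_0Vmem S; first by rewrite cards0.
have n0 : (0 < n)%N by have [_ /andP[a b]] := rk_vertex (SP _ V0S); apply: ltn_trans b.
have inj : {in S &, injective rk}.
  move=> V W VS WS E.
  have [sV _] := rk_vertex (SP _ VS); have [sW _] := rk_vertex (SP _ WS).
  rewrite -E in sW; have [|] := cS V W VS WS; first exact: summand_eq sV sW.
  by move/(summand_eq sW sV).
have -> : #|S| = size [seq rk V | V <- enum S] by rewrite size_map -cardE.
rewrite -(size_iota 1 n.-1); apply: uniq_leq_size.
  rewrite map_inj_in_uniq ?enum_uniq // => V W; rewrite !mem_enum; exact: inj.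
move=> k /mapP[V]; rewrite mem_enum => VS ->; have [_] := rk_vertex (SP _ VS).
by rewrite mem_iota add1n (prednK n0).
Qed.

(** Every flag is good: a largest chain containing [S] meets every rank, because a missing rank
    could be filled by [summand_gap]. *)
Lemma chain_complete S : S \in chains ->
  exists C, [/\ C \in chains, S \subset C & #|C| = n.-1].
Proof.
move=> SC; pose Q C := (C \in chains) && (S \subset C).
have QS : Q S by rewrite /Q SC /=.
case: (arg_maxnP (fun C : {set {set vec}} => #|C|) QS) => C /andP[CC SC'] Cmax.
exists C; split=> //; apply/eqP; rewrite eqn_leq chain_card //=.
have /chainsP[/subsetP CP cC] := CC.
have step k : (k < n)%N -> exists2 V, (V == [set 0]) || (V \in C) & summand k V.
  elim: k => [|k IH] kn; first by exists [set 0]; rewrite ?eqxx //; apply: summand0.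
  have [V VC sV] := IH (ltnW kn).
  (* A smallest such [B] is the successor of [V] in the chain, topped by the whole module; adjoining
     to [V] a line of [B] keeps comparability with the chain. *)
  pose up B := ((B == setT) || (B \in C)) && (V \proper B).
  have upT : up setT.
    by rewrite /up eqxx (ltn_proper sV (summandT R n)) ?subsetT // ltnW.
  case: (arg_minnP (fun B : {set vec} => #|B|) upT) => B /andP[BC VB] Bmin.
  have [b sB] : exists b, summand b B.
    case/orP: BC => [/eqP->|/CP/verticesP[]//]; exists n; exact: summandT.
  have [t [f [tB Vf tf]]] := summand_gap sV sB (proper_sub VB) (summand_ltn sV sB VB).
  have sW := adjoin_summand sV Vf tf; set W := adjoin V t in sW *.
  have WP : W \in vertices by rewrite (vertices_rank sW) kn.
  have VW : V \proper W by apply: ltn_proper sV sW (sub_adjoin V t) _.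
  have WB : W \subset B by apply: adjoin_sub sB (proper_sub VB) tB.
  have cW Z : Z \in C -> Z \subset W \/ W \subset Z.
    move=> ZC; have : Z \subset V \/ V \subset Z.
      case/orP: VC => [/eqP->|VC]; last exact: cC.
      right; rewrite sub1set; have /verticesP[[i sZ] _ _] := CP _ ZC.
      by case: (summand_lin sZ).
    case=> [ZV|VZ]; first by left; apply: subset_trans ZV (proper_sub VW).
    have [ZE|ZV] := eqVneq V Z; first by left; rewrite -ZE; apply: proper_sub.
    have upZ : up Z by rewrite /up ZC orbT properEneq ZV.
    right; apply: subset_trans WB _; case/orP: BC => [/eqP BT|BC].
      suff -> : Z = setT by apply: subsetT.
      by apply/eqP; rewrite eqEcard subsetT -BT Bmin.
    have [//|ZB] := cC _ _ BC ZC.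
    suff -> : Z = B by [].
    by apply/eqP; rewrite eqEcard ZB Bmin.
  exists W => //; apply/orP; right; apply/negPn/negP => WC.
  have : (#|W |: C| <= #|C|)%N.
    apply: Cmax; rewrite /Q (subset_trans SC' (subsetUr _ _)) andbT; apply/chainsP; split.
      by rewrite subUset sub1set WP; apply/subsetP.
    move=> Z Z'; rewrite !inE => /predU1P[->|ZC] /predU1P[->|ZC'].
    - by left.
    - by have [] := cW _ ZC'; [right|left].
    - exact: cW.
    - exact: cC.
  by rewrite cardsU1 WC ltnn.
have -> : #|C| = size [seq rk V | V <- enum C] by rewrite size_map -cardE.
rewrite -(size_iota 1 n.-1); apply: uniq_leq_size; first exact: iota_uniq.
move=> k; rewrite mem_iota => /andP[k0 kn].
have {}kn : (k < n)%N by lia.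
have [V VC sV] := step _ kn; apply/mapP; exists V; last by rewrite (rk_summand sV).
rewrite mem_enum; case/orP: VC => // /eqP E; rewrite E in sV.
by rewrite (summand_inj sV (summand0 R n)) in k0.
Qed.

Lemma tits_facesE : tits_faces R n = chains.
Proof.
have flag S : S \in chains -> is_flag S.
  move=> /chainsP[/subsetP SP cS]; split=> // V /SP/verticesP[[k /summandP[dV fV]] V0 VT].
  by split=> //; exists k.
apply/setP => S; rewrite inE; apply/asboolP/idP => [[SP [[fS cS] _]]|SC].
  apply/chainsP; split=> //; apply/subsetP => V /[dup] VS /SP[dV [V0 [VT [[k fV] _]]]].
  by apply/verticesP; split=> //; exists k; apply/summandP.
split=> [V VS|].
  have /chainsP[/subsetP/(_ V VS) VP _] := SC.
  have [sV _] := rk_vertex VP; have /verticesP[_ V0 VT] := VP.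
  have /GrassP := sV; rewrite inE => /asboolP[dV [fV qV]].
  by split=> //; split=> //; split=> //; split=> //; exists (rk V).
split; first exact: flag.
by have [C [CC SC' cardC]] := chain_complete SC; exists C; split=> //; split=> //; apply: flag.
Qed.

(* Minus the reduced Euler characteristic. *)
Definition euler := \sum_(S in chains) (-1) ^+ #|S| : int.

End Translation.

Lemma stRank_euler (R : finComNzRingType) n :
  (stRank R n.+1)%:Z = (-1) ^+ n * euler R n.+1.
Proof.
rewrite /stRank tits_facesE; apply: betti_euler.
- by move=> V; rewrite properxx.
- exact: nested_proper.
- exact: nested_sym.
- apply: (spherical_exact (@nested_sym _) (@nested_irr _)).
    by apply: tournamentP; [exact: nested_proper|exact: nested_sym].
  apply: (@avoiding_spherical R n.+1 n 0 [set 0] setT 0 0 0); rewrite ?add0n.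
  + exact: summand0.
  + exact: summandT.
  + exact: subsetT.
  + by rewrite mul0r.
  + by rewrite scale0r.
  + by rewrite inE.
  + by move=> x _; rewrite pair0r.
  + by rewrite pair0r.
- by move=> S /chain_card.
Qed.

(** * The recursion *)

Local Notation chains R n := (cliques (@nested _) (vertices R n)).

Section Below.
Variables (R : finComNzRingType) (k n : nat).
Variables (V : {set 'rV[R]_n}) (Y : 'M[R]_(k, n)) (X : 'M[R]_(n, k)).
Hypotheses (YX : Y *m X = 1%:M) (VE : V = rowset Y) (VP : V \in vertices R n).
Implicit Types (U : {set 'rV[R]_k}) (W : {set 'rV[R]_n}).

Definition ext U : {set 'rV[R]_n} := [set u *m Y | u in U].

Lemma mulY_inj : injective (mulmx^~ Y : 'rV[R]_k -> 'rV[R]_n).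
Proof. by apply: (can_inj (g := mulmx^~ X)) => u; rewrite -mulmxA YX mulmx1. Qed.

Lemma ext_inj : injective ext.
Proof. exact/imset_inj/mulY_inj. Qed.

Lemma ext_sub U : ext U \subset V.
Proof. by rewrite VE; apply/subsetP => _ /imsetP[u _ ->]; apply: imset_f. Qed.

Lemma ext_subS U U' : ext U \subset ext U' -> U \subset U'.
Proof.
move=> /subsetP sub; apply/subsetP => u uU.
by have /imsetP[u' u'U /mulY_inj->] := sub _ (imset_f (mulmx^~ Y) uU).
Qed.

Lemma summand_base : summand k V.
Proof. by exists Y, X. Qed.

Lemma ext_summand i U : summand i U -> summand i (ext U).
Proof.
move=> [Z [Z' [ZZ' ->]]]; exists (Z *m Y), (X *m Z'); split.
  by rewrite mulmxA -(mulmxA Z) YX mulmx1.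
apply/setP => x; apply/imsetP/imsetP => [[_ /imsetP[w _ ->] ->]|[w _ ->]].
  by exists w => //; rewrite mulmxA.
by exists (w *m Z); rewrite ?mulmxA ?imset_f //; apply: imset_f.
Qed.

Lemma ext_surj i W : summand i W -> W \subset V -> exists2 U, summand i U & ext U = W.
Proof.
move=> [Z [Z' [ZZ' WE]]] /subsetP WV.
have ZE : Z *m X *m Y = Z.
  apply/row_matrixP => j; rewrite !row_mul.
  have : row j Z \in V by apply: WV; rewrite WE rowE; apply: imset_f.
  by rewrite VE => /imsetP[u _ ->]; rewrite -[u *m Y *m X]mulmxA YX mulmx1.
exists (rowset (Z *m X)).
  by exists (Z *m X), (Y *m Z'); split; rewrite // mulmxA ZE.
rewrite WE; apply/setP => x; apply/imsetP/imsetP => [[_ /imsetP[w _ ->] ->]|[w _ ->]].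
  by exists w => //; rewrite -!mulmxA (mulmxA Z) ZE.
by exists (w *m (Z *m X)); [apply: imset_f|rewrite -!mulmxA (mulmxA Z) ZE].
Qed.

Lemma ext_vertex U : U \in vertices R k -> ext U \in vertices R n /\ ext U \proper V.
Proof.
move=> UP; have [sU /andP[U0 Uk]] := rk_vertex UP.
have sE := ext_summand sU; split; last exact: ltn_proper sE summand_base (ext_sub U) Uk.
rewrite (vertices_rank sE) U0 (leq_trans Uk) //; exact: summand_leqN summand_base.
Qed.

Lemma ext_vertex_surj W : W \in vertices R n -> W \proper V ->
  exists2 U, U \in vertices R k & ext U = W.
Proof.
move=> WP WV; have [sW /andP[W0 _]] := rk_vertex WP.
have [U sU UW] := ext_surj sW (proper_sub WV); exists U => //.
by rewrite (vertices_rank sU) W0 (summand_ltn sW summand_base WV).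
Qed.

Definition add_top (S : {set {set 'rV[R]_k}}) := V |: ext @: S.

Lemma add_top_notin S : S \in chains R k -> V \notin ext @: S.
Proof.
move=> /chainsP[/subsetP SP _]; apply/negP => /imsetP[U /SP/ext_vertex[_ +] E].
by rewrite -E properxx.
Qed.

Lemma add_top_inj : {in chains R k &, injective add_top}.
Proof.
move=> S S' SC SC' E; apply: (imset_inj ext_inj).
by rewrite -(setU1K (add_top_notin SC)) -(setU1K (add_top_notin SC')) -!/(add_top _) E.
Qed.

Lemma add_top_chains : add_top @: chains R k =
  [set S in chains R n | (V \in S) && [forall W in S, W \subset V]].
Proof.
apply/setP => S; rewrite inE; apply/imsetP/andP => [[S' SC ->]|[SC /andP[VS /forall_inP SV]]].
  have /chainsP[/subsetP SP cS] := SC.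
  rewrite setU11 /=; split; last first.
    by apply/forall_inP => W /setU1P[->|/imsetP[U _ ->]] //; apply: ext_sub.
  apply/chainsP; split.
    rewrite subUset sub1set VP; apply/subsetP => _ /imsetP[U /SP UP ->].
    by have [] := ext_vertex UP.
  move=> _ _ /setU1P[->|/imsetP[U US ->]] /setU1P[->|/imsetP[U' US' ->]].
  - by left.
  - by right; apply: ext_sub.
  - by left; apply: ext_sub.
  - by have [] := cS U U' US US'; [left|right]; apply: imsetS.
have /chainsP[/subsetP SP cS] := SC.
have surj W : W \in S -> W != V -> exists2 U, U \in vertices R k & ext U = W.
  by move=> WS WV; apply: ext_vertex_surj; rewrite ?SP // properEneq WV SV.
exists [set U in vertices R k | ext U \in S].
  apply/chainsP; split; first by apply/subsetP => U; rewrite inE => /andP[].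
  move=> U U'; rewrite !inE => /andP[_ US] /andP[_ US'].
  by have [] := cS _ _ US US' => /ext_subS; [left|right].
apply/setP => W; apply/idP/setU1P => [WS|[->|/imsetP[U + ->]]] //.
  have [|WV] := eqVneq W V; [by left|right].
  by have [U UP UW] := surj W WS WV; apply/imsetP; exists U; rewrite // inE UP UW.
by rewrite inE => /andP[].
Qed.

(** Adding [V] changes the parity of each flag, hence the sign. *)
Lemma euler_top :
  \sum_(S in chains R n | (V \in S) && [forall W in S, W \subset V]) (-1) ^+ #|S|
  = - euler R k.
Proof.
rewrite /euler -sumrN -big_set -add_top_chains big_imset; last exact: add_top_inj.
apply: eq_bigr => S SC.
by rewrite cardsU1 (add_top_notin SC) card_imset ?exprS ?mulN1r //; apply: ext_inj.
Qed.

End Below.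

(** The leading [1] is the empty flag, the only one without a largest term; the contribution of a
    largest term depends on its rank alone. *)
Lemma euler_rec (R : finComNzRingType) n :
  euler R n = 1 - \sum_(1 <= k < n) #|Grass R n k|%:Z * euler R k.
Proof.
pose isTop (S : {set {set 'rV[R]_n}}) V := (V \in S) && [forall W in S, W \subset V].
have top1 S : S \in chains R n -> S != set0 ->
    exists2 V, V \in vertices R n & isTop S =1 pred1 V.
  move=> /chainsP[/subsetP SP cS] /set0Pn[V0 V0S].
  case: (arg_maxnP (fun V : {set 'rV[R]_n} => #|V|) V0S) => V /= VS0 Vmax.
  have VS : V \in S := VS0.
  have VT : isTop S V.
    rewrite /isTop VS; apply/forall_inP => W WS; have [//|VW] := cS W V WS VS.
    by rewrite (_ : W = V) //; apply/esym/eqP; rewrite eqEcard VW; apply: Vmax.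
  exists V; first exact: SP.
  move=> W; apply/idP/eqP => [/andP[WS /forall_inP WT]|->] //.
  have /andP[_ /forall_inP VT'] := VT.
  by apply/eqP; rewrite eqEsubset VT' // WT.
have C0 : set0 \in chains R n by apply/chainsP; split=> [|V W]; rewrite ?sub0set ?inE.
rewrite {1}/euler (bigD1 set0) //= cards0 expr0; congr (_ + _).
transitivity (\sum_(V in vertices R n)
    \sum_(S in chains R n | isTop S V) (-1) ^+ #|S| : int).
  rewrite (exchange_big_dep (fun S => S \in chains R n)) /=; last by move=> V S _ /andP[].
  rewrite [RHS](bigD1 set0 C0) /= [X in _ = X + _]big_pred0 ?add0r => [|V]; last first.
    by rewrite /isTop in_set0 !andbF.
  apply: eq_bigr => S /andP[SC S0]; have [V VP VT] := top1 S SC S0.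
  rewrite (big_pred1 V) // => W; rewrite SC VT /=.
  by apply: andb_idl => /eqP->.
transitivity (\sum_(V in vertices R n) - euler R (rk V)).
  apply: eq_bigr => V VP; have [[Y [X [YX VE]]] _] := rk_vertex VP.
  exact: (euler_top YX VE VP).
rewrite sumrN; congr (- _).
rewrite big_geq_mkord /=.
under [RHS]eq_bigr do rewrite -sum1_card -natz natr_sum mulr_suml.
rewrite (exchange_big_dep (fun V => V \in vertices R n)) /=; last first.
  by move=> k V k0 /GrassP sV; rewrite (vertices_rank sV) k0 ltn_ord.
apply: eq_bigr => V VP; have [sV /andP[k0 kn]] := rk_vertex VP.
rewrite (bigD1 (Ordinal kn)) /=; last by rewrite k0; apply/GrassP.
rewrite mul1r big1 ?addr0 // => k /andP[/andP[_ /GrassP sV'] /eqP[]].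
by apply: val_inj; apply: summand_inj sV' sV.
Qed.

Theorem theoremD (R : finComNzRingType) (n : nat) (hn : (1 <= n)%N) :
  ((stRank R n)%:Z =
   \sum_(1 <= i < n.+1)
      (-1) ^+ i.-1 * (#|Grass R n (n - i)|)%:Z * (stRank R (n - i))%:Z)%R.
Proof.
case: n hn => // n _.
have Grass0 : #|Grass R n.+1 0| = 1%N.
  suff -> : Grass R n.+1 0 = [set [set 0]] by rewrite cards1.
  apply/setP => V; rewrite [RHS]inE; apply/GrassP/eqP => [sV|->]; last exact: summand0.
  apply/esym/(summand_eq (summand0 _ _) sV); rewrite sub1set.
  by case: (summand_lin sV).
(* The last term, with the zero summand and [d_0 = 1], is the contribution of the empty flag. *)
rewrite stRank_euler euler_rec [in RHS]big_nat_recr //= subnn Grass0 !mulr1 addrC.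
rewrite mulrBr mulr1; congr (_ + _).
rewrite [in RHS]big_nat_rev mulr_sumr -sumrN /=.
apply: eq_big_nat => k /andP[k0 kn].
have -> : (n.+1 - (1 + n.+1 - k.+1) = k)%N by lia.
have -> : (1 + n.+1 - k.+1).-1 = (n - k)%N by lia.
case: k k0 kn => // k _ kn; rewrite stRank_euler.
(* Combined with the sign in [stRank_euler], the sign of the recursion becomes the opposite of
   [(-1) ^+ n] for every rank. *)
have -> : (-1) ^+ n = (-1) ^+ (n - k.+1) * (-1) ^+ k.+1 :> int.
  by rewrite -exprD subnK // -ltnS.
by rewrite exprS; ring.
Qed.
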